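(* Let $\{f_n\}_{n=1}^\infty$ be a sequence of random variables on a probability space $(\Omega,\Sigma,\mathbb P)$ containing a subsequence $\{f_{n_k}\}_{k=1}^\infty$ such that: 1) $|f_{n_k}(\omega)|\le D$ for all $k$ and $\omega\in\Omega$; 2) $f_{n_k}\to0$ weakly in $L_2$; 3) $d=\inf_k\|f_{n_k}\|_2>0$. Then there exist a subsystem $\{\varphi_i\}_{i=1}^\infty\subset\{f_n\}_{n=1}^\infty$ and a constant $C\ge1$ depending only on $D$ and $d$ such that for every $t\ge1$ and every $a=(a_i)\in\ell_2$ the series $\sum_i a_i\varphi_i$ converges in $L_t$ and $$C^{-1}\mathcal K_{1,2}(\sqrt t,a)\le\Big\|\sum_{i=1}^\infty a_i\varphi_i\Big\|_t\le C\,\mathcal K_{1,2}(\sqrt t,a).$$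
   Context: $\|f\|_p=(\mathbb E|f|^p)^{1/p}$. For $a\in\ell_2$ and $t>0$, $\mathcal K_{1,2}(t,a)=\inf\{\|b\|_{\ell_1}+t\|c\|_{\ell_2}: a=b+c,\ b\in\ell_1,\ c\in\ell_2\}$. *)

(* Defs.v *)
From HB Require Import structures.
From mathcomp Require Import all_boot all_order all_algebra.
From mathcomp Require Import all_classical all_reals all_analysis.
Set Implicit Arguments. Unset Strict Implicit. Unset Printing Implicit Defensive.
Import Order.TTheory GRing.Theory Num.Theory.
Local Open Scope classical_set_scope.
Local Open Scope ring_scope.

Section defs.
Context {R : realType}.
Local Open Scope ereal_scope.

Definition in_l2 (a : nat -> R) : Prop :=
  'N[@counting _ R]_(2%:E)[EFin \o a] < +oo.

Definition K12 (t : R) (a : nat -> R) : \bar R :=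
  ereal_inf [set x | exists b c : nat -> R,
    [/\ (forall i, a i = b i + c i)%R,
        'N[@counting _ R]_(1%:E)[EFin \o b] < +oo,
        'N[@counting _ R]_(2%:E)[EFin \o c] < +oo &
        x = 'N[@counting _ R]_(1%:E)[EFin \o b]
            + t%:E * 'N[@counting _ R]_(2%:E)[EFin \o c]]].

Definition weak_L2_to0 {d} {T : measurableType d} (P : probability T R)
  (g : nat -> T -> R) : Prop :=
  forall h : T -> R, measurable_fun setT h ->
    'N[P]_(2%:E)[EFin \o h] < +oo ->
    (fun k => \int[P]_x ((g k x * h x)%R)%:E) @ \oo --> 0.
End defs.

(* Main.v *)
(* Normalize the subsequence to |g_k| <= 1.  Let L u be the limit of E[g_k^2 u] along an
   ultrafilter containing the cofinite sets; a Bessel-type argument gives L(g_k h) -> 0 along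
   it for every bounded h.  One can thus choose the subsystem greedily so that each new g_n is
   almost orthogonal, for E and for L, to all monomials with exponents <= 2 in the previous
   g_j, and so that E[g_n^2 h] is close to L h for all such monomials h.

   Upper bound: for |q_j| <= p_j these relations give
   E prod (p_j + q_j g_j) <= 2 prod p_j; together with
   e^(ag) <= cosh a + g sinh a this makes the sums subgaussian, so that
   |sum a_i g_i|_t <= C sqrt t |a|_2, while |sum a_i g_i|_t <= |a|_1 is trivial.

   Lower bound for t >= 2, by duality: clipping a at a suitable level produces x with
   |x_j| <= 1, sum x_j^2 <= t and sum a_j x_j >= K_{1,2}(sqrt t, a).  The Riesz product
   G = prod (1 + x_j g_j) satisfies E G <= 2 and E G^2 <= 2 e^t, hence its norm in the dual
   exponent is bounded, and E[g_i G] is x_i E[g_i^2 prod_{j<i} (1 + x_j g_j)] up to a summable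
   error, where the expectation is close to L 1 = lim E g_k^2 > 0.  For 1 <= t < 2 the bound
   follows from the case t = 2 and the fourth moment. *)
Require Import Defs.
From HB Require Import structures.
From mathcomp Require Import all_boot all_order all_algebra.
From mathcomp Require Import all_classical all_reals all_analysis.
From mathcomp Require Import measurable_realfun ring lra.
Import Order.TTheory GRing.Theory Num.Theory.
Import numFieldNormedType.Exports.
Local Open Scope classical_set_scope.
Local Open Scope ring_scope.

(** * Bounded random variables *)

Section bounded_measurable.
Context {d : measure_display} {T : measurableType d} {R : realType}.
Implicit Types (u v : T -> R) (c : R).

Definition bmeas u := measurable_fun setT u /\ exists M, forall x, `|u x| <= M.

Lemma bmeas_cst c : bmeas (fun=> c).
Proof. by split=> //; exists `|c|. Qed.

Lemma bmeasD {u v} : bmeas u -> bmeas v -> bmeas (fun x => u x + v x).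
Proof.
move=> [mu [M uM]] [mv [N vN]]; split; first exact: measurable_funD.
by exists (M + N) => x; rewrite (le_trans (ler_normD _ _))// lerD.
Qed.

Lemma bmeasM {u v} : bmeas u -> bmeas v -> bmeas (fun x => u x * v x).
Proof.
move=> [mu [M uM]] [mv [N vN]]; split; first exact: measurable_funM.
by exists (M * N) => x; rewrite normrM ler_pM.
Qed.

Lemma bmeasZ {u} c : bmeas u -> bmeas (fun x => c * u x).
Proof. exact: bmeasM (bmeas_cst c). Qed.

Lemma bmeasX {u} n : bmeas u -> bmeas (fun x => u x ^+ n).
Proof.
move=> [mu [M uM]]; split; first exact: measurable_funX.
by exists (M ^+ n) => x; rewrite normrX lerXn2r// nnegrE (le_trans _ (uM x)).
Qed.

Lemma bmeas_norm {u} : bmeas u -> bmeas (fun x => `|u x|).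
Proof.
move=> [mu [M uM]]; split; first exact: measurableT_comp.
by exists M => x; rewrite normr_id.
Qed.

Lemma bmeas_sum {I : Type} (s : seq I) (F : I -> T -> R) :
  (forall i, bmeas (F i)) -> bmeas (fun x => \sum_(i <- s) F i x).
Proof.
move=> bF; elim: s => [|i s IH].
  by under eq_fun do rewrite big_nil; exact: bmeas_cst.
by under eq_fun do rewrite big_cons; exact: bmeasD.
Qed.

Lemma bmeas_prod {I : Type} (s : seq I) (F : I -> T -> R) :
  (forall i, bmeas (F i)) -> bmeas (fun x => \prod_(i <- s) F i x).
Proof.
move=> bF; elim: s => [|i s IH].
  by under eq_fun do rewrite big_nil; exact: bmeas_cst.
by under eq_fun do rewrite big_cons; exact: bmeasM.
Qed.

Lemma bmeas_expR {u} : bmeas u -> bmeas (fun x => expR (u x)).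
Proof.
move=> [mu [M uM]]; split; first exact: measurableT_comp.
exists (expR M) => x; rewrite ger0_norm ?expR_ge0// ler_expR.
by rewrite (le_trans (ler_norm _)).
Qed.

Lemma bmeas_powR {u} p : 0 <= p -> bmeas u -> bmeas (fun x => `|u x| `^ p).
Proof.
move=> p0 bu; have [mu [M uM]] := bmeas_norm bu; split.
  exact: (measurableT_comp (measurable_powR _)).
exists (M `^ p) => x; have {}uM : `|u x| <= M by rewrite -[leLHS]normr_id.
by rewrite ger0_norm ?powR_ge0// ge0_ler_powR ?nnegrE// (le_trans _ uM).
Qed.

End bounded_measurable.

Ltac solve_bmeas := solve [repeat first
  [ assumption | match goal with H : forall _, bmeas _ |- _ => apply: H end
  | apply: bmeas_cst | apply: bmeasX | apply: bmeasD | apply: bmeasM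
  | apply: bmeas_norm | apply: bmeas_expR | apply: bmeas_prod => ?
  | apply: bmeas_sum => ? ]].

(** * Real-valued expectation and Cauchy-Schwarz for bounded random variables *)

Section expectation.
Context {d : measure_display} {T : measurableType d} {R : realType}.
Variable P : probability T R.
Implicit Types (u v : T -> R) (c : R).

Definition Ex u : R := \int[P]_x u x.

Lemma bmeas_integrable {u} : bmeas u -> P.-integrable setT (EFin \o u).
Proof.
move=> [mu [M uM]]; apply: measurable_bounded_integrable => //.
  by rewrite (le_lt_trans (probability_le1 _ _))// ltry.
exists M; split; first exact: num_real.
by move=> N MN x _; apply: (le_trans (uM x)); exact: ltW.
Qed.

Lemma EFin_Ex {u} : bmeas u -> (Ex u)%:E = (\int[P]_x (u x)%:E)%E.
Proof.
move=> bu; rewrite /Ex /Rintegral fineK//.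
exact: (integrable_fin_num measurableT (bmeas_integrable bu)).
Qed.

Lemma ExD {u v} : bmeas u -> bmeas v -> Ex (fun x => u x + v x) = Ex u + Ex v.
Proof. by move=> bu bv; rewrite /Ex RintegralD//; exact: bmeas_integrable. Qed.

Lemma ExZ {u} c : bmeas u -> Ex (fun x => c * u x) = c * Ex u.
Proof. by move=> bu; rewrite /Ex RintegralZl//; exact: bmeas_integrable. Qed.

Lemma Ex_cst c : Ex (fun=> c) = c.
Proof.
rewrite /Ex Rintegral_cst// [fine _](_ : _ = 1) ?mulr1//.
exact: (congr1 fine (probability_setT P)).
Qed.

Lemma ler_Ex {u v} : bmeas u -> bmeas v -> (forall x, u x <= v x) -> Ex u <= Ex v.
Proof.
by move=> bu bv uv; apply: le_Rintegral => //; exact: bmeas_integrable.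
Qed.

Lemma Ex_ge0 u : (forall x, 0 <= u x) -> 0 <= Ex u.
Proof. by move=> u0; apply: Rintegral_ge0 => x _. Qed.

Lemma ler_norm_Ex {u} : bmeas u -> `|Ex u| <= Ex (fun x => `|u x|).
Proof. by move=> bu; apply: le_normr_Rintegral => //; exact: bmeas_integrable. Qed.

Lemma Ex_sum {I : Type} (s : seq I) (F : I -> T -> R) : (forall i, bmeas (F i)) ->
  Ex (fun x => \sum_(i <- s) F i x) = \sum_(i <- s) Ex (F i).
Proof.
move=> bF; elim: s => [|i s IH].
  by under eq_fun do rewrite big_nil; rewrite Ex_cst big_nil.
under eq_fun do rewrite big_cons.
by rewrite ExD ?IH ?big_cons//; exact: bmeas_sum.
Qed.

Lemma Ex_bound {u} M : bmeas u -> (forall x, `|u x| <= M) -> `|Ex u| <= M.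
Proof.
move=> bu uM; rewrite (le_trans (ler_norm_Ex bu))// -[leRHS]Ex_cst.
by apply: ler_Ex => //; [exact: bmeas_norm|exact: bmeas_cst].
Qed.

(* Cauchy-Schwarz, from the nonnegativity of [Ex ((u - s v)^2)] with [s] optimal. *)
Lemma Ex_sqrM {u v} : bmeas u -> bmeas v ->
  Ex (fun x => u x * v x) ^+ 2 <= Ex (fun x => u x ^+ 2) * Ex (fun x => v x ^+ 2).
Proof.
move=> bu bv.
have H (s r : R) : 0 <= s ^+ 2 * Ex (fun x => u x ^+ 2)
    + 2 * (s * r) * Ex (fun x => u x * v x) + r ^+ 2 * Ex (fun x => v x ^+ 2).
  rewrite -!ExZ; [|solve_bmeas..].
  rewrite -!ExD; [|solve_bmeas..].
  apply: Ex_ge0 => x; rewrite [leRHS](_ : _ = (s * u x + r * v x) ^+ 2) ?sqr_ge0//.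
  by ring.
have : 0 <= Ex (fun x => v x ^+ 2) by apply: Ex_ge0 => x; exact: sqr_ge0.
have : 0 <= Ex (fun x => u x ^+ 2) by apply: Ex_ge0 => x; exact: sqr_ge0.
move: H; move: (Ex (fun x => u x ^+ 2)) (Ex (fun x => u x * v x)) => a b.
move: (Ex _) => c H.
(* When [a = 0] the form is affine in [s], and its nonnegativity forces [b = 0]; otherwise
   [s = - b], [r = a] gives [a * (a * c - b ^+ 2) >= 0]. *)
rewrite le_eqVlt => /predU1P[a0 c0|a0 c0].
  have {}H r : 0 <= 2 * r * b + c by have := H r 1; rewrite -a0; lra.
  have [->|b0] := eqVneq b 0; first by rewrite -a0 expr0n mul0r.
  have := H (- (c + 1) / (2 * b)).
  rewrite (_ : 2 * _ * b = - (c + 1)); last by field.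
  by lra.
by have := H (- b) a; nra.
Qed.

End expectation.

(** * Extraction of the subsequence *)

(** Compactness of [[-M, M]] provides a cluster point, and an ultrafilter converges to each of its
    cluster points. *)
Lemma ultra_bounded_cvg {R : realType} {I : Type} (U : set_system I) (u : I -> R) M :
  UltraFilter U -> (forall i, `|u i| <= M) -> cvg (u @ U).
Proof.
move=> UU uM.
have [p [_ pcl]] : ([set` `[- M, M]] `&` cluster (u @ U)) !=set0.
  apply: segment_compact; rewrite /fmap/=.
  by apply: filterE => i; rewrite /= in_itv/= -ler_norml.
apply/cvg_ex; exists p => B pB.
have [//|UnB] := in_ultra_setVsetC (u @^-1` B) UU.
by have [? []] := pcl (~` B) B UnB pB.
Qed.

Section selection.
Context {d : measure_display} {T : measurableType d} {R : realType}.
Variable P : probability T R.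
Local Notation E := (Ex P).
Variable f : nat -> T -> R.
Hypothesis bf : forall k, bmeas (f k).
Hypothesis f1 : forall k x, `|f k x| <= 1.
Hypothesis f0 : forall h, bmeas h -> E (fun x => f k x * h x) @[k --> \oo] --> (0 : R).
Variable U : set_system nat.
Hypothesis UU : UltraFilter U.
Hypothesis ooU : \oo `<=` U.

(** Integration against a weak limit of [f k ^+ 2]; taking it along an ultrafilter makes it exist
    for all bounded [h] at once and keeps it linear. *)
Definition limsq h : R := lim (E (fun x => f k x ^+ 2 * h x) @[k --> U]).

Lemma sqf1 k x : f k x ^+ 2 <= 1.
Proof. by rewrite -real_normK ?num_real// expr_le1. Qed.

Lemma bmeas_sqf k h : bmeas h -> bmeas (fun x => f k x ^+ 2 * h x).
Proof. by move=> bh; apply: bmeasM => //; exact: bmeasX. Qed.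

Lemma limsq_cvg h : bmeas h ->
  E (fun x => f k x ^+ 2 * h x) @[k --> U] --> limsq h.
Proof.
move=> bh; have [_ [M hM]] := bh.
apply: (@ultra_bounded_cvg _ _ _ _ M) => k.
apply: Ex_bound => [|x]; first exact: bmeas_sqf.
rewrite normrM ger0_norm ?sqr_ge0// (le_trans _ (hM x))//.
by rewrite ler_piMl// sqf1.
Qed.

Lemma limsqD h1 h2 : bmeas h1 -> bmeas h2 ->
  limsq (fun x => h1 x + h2 x) = limsq h1 + limsq h2.
Proof.
move=> b1 b2; apply/cvg_lim => //.
rewrite [X in X @ _](_ : _ = (fun k => E (fun x => f k x ^+ 2 * h1 x)
  + E (fun x => f k x ^+ 2 * h2 x))).
  by apply: cvgD; exact: limsq_cvg.
apply/funext => k; rewrite -ExD; [|exact: bmeas_sqf..].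
by congr Ex; apply/funext => x; rewrite mulrDr.
Qed.

Lemma limsqZ c h : bmeas h -> limsq (fun x => c * h x) = c * limsq h.
Proof.
move=> bh; apply/cvg_lim => //.
rewrite [X in X @ _](_ : _ = (fun k => c * E (fun x => f k x ^+ 2 * h x))).
  by apply: cvgMr; exact: limsq_cvg.
apply/funext => k; rewrite -ExZ; last exact: bmeas_sqf.
by congr Ex; apply/funext => x; rewrite mulrCA.
Qed.

Lemma limsq_le M h : bmeas h -> (forall k, E (fun x => f k x ^+ 2 * h x) <= M) ->
  limsq h <= M.
Proof.
by move=> bh hM; apply: (cvgr_to_le (limsq_cvg _ bh)); exact: nearW.
Qed.

Lemma limsq_ge M h : bmeas h -> (forall k, M <= E (fun x => f k x ^+ 2 * h x)) ->
  M <= limsq h.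
Proof.
by move=> bh hM; apply: (cvgr_to_ge (limsq_cvg _ bh)); exact: nearW.
Qed.

Lemma near_weak h eps : bmeas h -> 0 < eps ->
  \forall k \near U, `|E (fun x => f k x * h x)| <= eps.
Proof.
move=> bh eps0; apply: ooU; have /cvgrPdist_le/(_ _ eps0) := f0 _ bh.
by apply: filterS => k; rewrite sub0r normrN.
Qed.

(* Otherwise, for some bounded [h] and [c > 0], greedily adding almost orthogonal terms of the
   sequence yields [g] with [limsq (h * g) >= n c] and [E g^2 <= 2 n], which
   contradicts [limsq (h * g) <= |h| (E g^2)^(1/2)] for large [n]. *)
Lemma near_limsq_ge h c : bmeas h -> 0 < c ->
  ~ (\forall k \near U, c <= limsq (fun x => h x * f k x)).
Proof.
move=> bh c0 near_c.
have step n : exists g, [/\ bmeas g, n%:R * c <= limsq (fun x => h x * g x) &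
    E (fun x => g x ^+ 2) <= 2 * n%:R].
  elim: n => [|n [g [bg gc gn]]].
    exists (fun=> 0); split; first exact: bmeas_cst.
      rewrite mul0r; apply: limsq_ge => [|k].
        by apply: bmeasM => //; exact: bmeas_cst.
      by under eq_fun do rewrite !mulr0; rewrite Ex_cst.
    by under eq_fun do rewrite expr0n; rewrite Ex_cst mulr0.
  have half : 0 < 1 / 2 :> R by lra.
  have [k [ck orth]] : exists k, c <= limsq (fun x => h x * f k x) /\
      `|E (fun x => f k x * g x)| <= 1 / 2.
    by apply: (@filter_ex _ U); apply: filterI => //; exact: near_weak.
  exists (fun x => g x + f k x); split; first exact: bmeasD.
    under eq_fun do rewrite mulrDr.
    by rewrite limsqD; [|exact: bmeasM..]; rewrite -natr1 mulrDl mul1r lerD.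
  rewrite (_ : (fun x => _) =
      (fun x => (g x ^+ 2 + 2 * (f k x * g x)) + f k x ^+ 2)); last first.
    by apply/funext => x; ring.
  have b1 := bmeasZ 2 (bmeasM (bf k) bg).
  rewrite ExD; [|by apply: bmeasD => //; exact: bmeasX|exact: bmeasX].
  rewrite ExD//; last exact: bmeasX.
  rewrite ExZ; last exact: bmeasM.
  have : E (fun x => f k x ^+ 2) <= 1.
    rewrite -[leRHS](Ex_cst P); apply: ler_Ex; [exact: bmeasX|exact: bmeas_cst|].
    by move=> x; exact: sqf1.
  by move: orth; rewrite ler_norml -(natr1 n) => /andP[_]; lra.
have [_ [M hM]] := bh.
have {}hM x : `|h x| <= `|M| by rewrite (le_trans (hM x))// ler_norm.
have M0 := normr_ge0 M; move: `|M| M0 hM => {}M M0 hM.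
(* Cauchy-Schwarz with [f k ^+ 2 * h] bounded by [M] gives (n c)^2 <= 2 n M^2; dividing by n leaves
   a bound that fails for large n. *)
have bnd n : n%:R * c ^+ 2 <= 2 * M ^+ 2.
  have [->|n0] := posnP n; first by nra.
  have [g [bg gc gn]] := step n.
  have bhg := bmeasM bh bg.
  have : (n%:R * c) ^+ 2 <= M ^+ 2 * (2 * n%:R).
    have : limsq (fun x => h x * g x) <= Num.sqrt (M ^+ 2 * (2 * n%:R)).
      apply: limsq_le => // k.
      rewrite (le_trans (ler_norm _))// -sqrtr_sqr ler_wsqrtr//.
      rewrite (_ : (fun x => _) = (fun x => f k x ^+ 2 * h x * g x)); last first.
        by apply/funext => x; rewrite mulrA.
      rewrite (le_trans (Ex_sqrM P (bmeas_sqf k _ bh) bg))//.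
      rewrite ler_pM//; try by apply: Ex_ge0 => x; exact: sqr_ge0.
      rewrite -[leRHS](Ex_cst P); apply: ler_Ex => //.
      - by apply: bmeasX; exact: bmeas_sqf.
      - exact: bmeas_cst.
      move=> x; rewrite exprMn -[leRHS]mul1r ler_pM ?sqr_ge0//.
        by rewrite expr_le1 ?sqr_ge0// sqf1.
      by rewrite -real_normK ?num_real// lerXn2r// nnegrE (le_trans _ (hM x)).
    move=> /(le_trans gc) H; rewrite -[leRHS]sqr_sqrtr ?lerXn2r ?nnegrE//.
    - by rewrite mulr_ge0// ltW.
    - by rewrite mulr_ge0 ?mulr_ge0.
  have n0' : 0 < n%:R :> R by rewrite ltr0n.
  by move=> H; rewrite -(ler_pM2l n0'); nra.
have c2 : 0 < c ^+ 2 by rewrite exprn_gt0.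
have := archi_boundP (ltW (divr_gt0 (ltr_wpDl (mulr_ge0 (ler0n R 2) (sqr_ge0 M)) ltr01) c2)).
rewrite ltr_pdivrMr// => H; have := bnd (Num.bound ((2 * M ^+ 2 + 1) / c ^+ 2)).
by lra.
Qed.

(** For an ultrafilter, an event that does not hold near [U] has its complement near [U]; so
    [near_limsq_ge] for [h] and for [-h] bounds the value from both sides. *)
Lemma near_limsq h eps : bmeas h -> 0 < eps ->
  \forall k \near U, `|limsq (fun x => f k x * h x)| <= eps.
Proof.
move=> bh eps0.
have side (g : T -> R) : bmeas g -> \forall k \near U, ~ eps <= limsq (fun x => g x * f k x).
  move=> bg; have [H|//] := in_ultra_setVsetC [set k | eps <= limsq (fun x => g x * f k x)] UU.
  by have := near_limsq_ge _ _ bg eps0 H.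
apply: filterS2 (side _ bh) (side _ (bmeasZ (-1) bh)) => k.
rewrite (_ : (fun x => -1 * h x * f k x) = (fun x => -1 * (h x * f k x))); last first.
  by apply/funext => x; rewrite mulrA.
rewrite limsqZ; last exact: bmeasM.
rewrite (_ : (fun x => f k x * h x) = (fun x => h x * f k x)); last first.
  by apply/funext => x; rewrite mulrC.
move=> /negP + /negP; rewrite -!ltNge ler_norml.
by move=> H1 H2; apply/andP; split; lra.
Qed.

(** Asks [Q] of every product of the entries of [s] with exponents 0, 1, 2. The recursion absorbs
    each chosen power into [Q], so filter and linearity arguments go by induction on [s] without
    multi-indices. *)
Fixpoint all_monomials (s : seq (T -> R)) (Q : (T -> R) -> Prop) : Prop :=
  if s is g :: s' then
    [/\ all_monomials s' Q, all_monomials s' (fun h => Q (fun x => h x * g x)) &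
        all_monomials s' (fun h => Q (fun x => h x * g x ^+ 2))]
  else Q (fun=> 1).

Lemma near_all_monomials (s : seq (T -> R)) (Q : nat -> (T -> R) -> Prop) :
  (forall g, List.In g s -> bmeas g) ->
  (forall h, bmeas h -> \forall k \near U, Q k h) ->
  \forall k \near U, all_monomials s (Q k).
Proof.
elim: s Q => [|g s IH] Q bs HQ /=; first by apply: HQ; exact: bmeas_cst.
have bg : bmeas g by apply: bs; left.
have {}bs h : List.In h s -> bmeas h by move=> hs; apply: bs; right.
have H1 := IH Q bs HQ.
have H2 := IH (fun k h => Q k (fun x => h x * g x)) bs
  (fun h bh => HQ _ (bmeasM bh bg)).
have H3 := IH (fun k h => Q k (fun x => h x * g x ^+ 2)) bs
  (fun h bh => HQ _ (bmeasM bh (bmeasX 2 bg))).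
by apply: filterS3 H1 H2 H3.
Qed.

(** In order: almost orthogonality under [E], almost orthogonality under the limit functional, and
    replacement of [E] by that functional once a square [f k ^+ 2] is present. *)
Definition small_against eps k h := [/\ `|E (fun x => f k x * h x)| <= eps,
  `|limsq (fun x => f k x * h x)| <= eps &
  `|E (fun x => f k x ^+ 2 * h x) - limsq h| <= eps].

Lemma small_against_near eps h : 0 < eps -> bmeas h ->
  \forall k \near U, small_against eps k h.
Proof.
move=> e0 bh; apply: filterS3 (near_weak _ _ bh e0) (near_limsq _ _ bh e0) _.
  by move=> k; exact: And3.
have /cvgrPdist_le/(_ _ e0) := limsq_cvg _ bh.
by apply: filterS => k; rewrite distrC.
Qed.

Lemma next_index (eps : R) (s : seq nat) : 0 < eps -> exists k,
  (forall j, j \in s -> (j < k)%N) /\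
  all_monomials [seq f j | j <- s] (small_against eps k).
Proof.
move=> e0; apply: (@filter_ex _ U); apply: filterI.
  apply: ooU; exists (\max_(j <- s) j).+1 => // k /= sk j js.
  by rewrite (leq_ltn_trans _ sk)//; exact: leq_bigmax_seq.
apply: near_all_monomials => [g|h bh]; last exact: small_against_near.
by elim: s => //= j s IH [<-|/IH].
Qed.

End selection.

(** * From monomials to products of quadratic factors *)

Section quadratic_products.
Context {d : measure_display} {T : measurableType d} {R : realType}.
Implicit Types (g : nat -> T -> R) (p q r : nat -> R) (L : (T -> R) -> R).

Definition qprod g p q r n : T -> R :=
  fun x => \prod_(j < n) (p j + q j * g j x + r j * g j x ^+ 2).

Lemma bmeas_qprod {g} p q r n : (forall k, bmeas (g k)) -> bmeas (qprod g p q r n).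
Proof. by move=> bg; rewrite /qprod; solve_bmeas. Qed.

Definition linear_bmeas L :=
  (forall u v, bmeas u -> bmeas v -> L (fun x => u x + v x) = L u + L v) /\
  (forall c u, bmeas u -> L (fun x => c * u x) = c * L u).

Lemma linear_bmeas_mul L v : bmeas v -> linear_bmeas L ->
  linear_bmeas (fun u => L (fun x => u x * v x)).
Proof.
move=> bv [LD LZ]; split=> [u1 u2 b1 b2|c u bu].
  by rewrite -LD; [congr L; apply/funext => x; rewrite mulrDl|exact: bmeasM..].
by rewrite -LZ; [congr L; apply/funext => x; rewrite mulrA|exact: bmeasM].
Qed.

(** Expanding the last factor splits [L] of the product into the functionals u -> L u, L (u g_n), L
    (u g_n^2), each covered by the induction hypothesis. The list is reversed so that its head is
    the last factor. *)
Lemma all_monomials_qprod {g} n L eps p q r : (forall k, bmeas (g k)) ->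
  linear_bmeas L ->
  all_monomials [seq g j | j <- rev (iota 0 n)] (fun h => `|L h| <= eps) ->
  `|L (qprod g p q r n)| <= eps * \prod_(j < n) (`|p j| + `|q j| + `|r j|).
Proof.
move=> bg; elim: n L => [|n IH] L linL.
  rewrite /= big_ord0 mulr1 (_ : qprod _ _ _ _ _ = fun=> 1)//.
  by apply/funext => x; rewrite /qprod big_ord0.
rewrite -addn1 iotaD rev_cat/= add0n => -[H0 H1 H2].
have bq := bmeas_qprod p q r n bg.
have bgn := bg n; have bgn2 := bmeasX 2 bgn.
have {}H0 := IH _ linL H0.
have {}H1 := IH _ (linear_bmeas_mul _ _ bgn linL) H1.
have {IH}H2 := IH _ (linear_bmeas_mul _ _ bgn2 linL) H2.
have [LD LZ] := linL.
rewrite addn1 big_ord_recr/= (_ : qprod g p q r n.+1 = fun x =>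
  (p n * qprod g p q r n x + q n * (qprod g p q r n x * g n x)) +
  r n * (qprod g p q r n x * g n x ^+ 2)); last first.
  by apply/funext => x; rewrite /qprod big_ord_recr/=; ring.
rewrite LD; [|solve_bmeas..].
rewrite LD; [|solve_bmeas..].
rewrite !LZ; [|solve_bmeas..].
rewrite mulrA; set B := eps * _; rewrite !mulrDr.
rewrite (le_trans (ler_normD _ _))// lerD//.
  rewrite (le_trans (ler_normD _ _))// lerD//.
    by rewrite normrM mulrC ler_wpM2r.
  by rewrite normrM mulrC ler_wpM2r.
by rewrite normrM mulrC ler_wpM2r.
Qed.

Variable P : probability T R.
Local Notation E := (Ex P).

Lemma linear_bmeas_Ex v : bmeas v -> linear_bmeas (fun u => E (fun x => v x * u x)).
Proof.
move=> bv; split=> [u1 u2 b1 b2|c u bu].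
  by rewrite -ExD; [congr Ex; apply/funext => x; rewrite mulrDr|exact: bmeasM..].
by rewrite -ExZ; [congr Ex; apply/funext => x; rewrite mulrCA|exact: bmeasM].
Qed.

(** The power of 4 leaves room for weights whose factors are as large as 2: after paying 2^n for [n]
    factors the error is still summable over [n]. *)
Definition small_products g L (eta : R) := forall n p q r,
  [/\ `|E (fun x => g n x * qprod g p q r n x)| <=
        eta / 4 ^+ n.+1 * \prod_(j < n) (`|p j| + `|q j| + `|r j|),
      `|L (fun x => g n x * qprod g p q r n x)| <=
        eta / 4 ^+ n.+1 * \prod_(j < n) (`|p j| + `|q j| + `|r j|) &
      `|E (fun x => g n x ^+ 2 * qprod g p q r n x) - L (qprod g p q r n)| <=
        eta / 4 ^+ n.+1 * \prod_(j < n) (`|p j| + `|q j| + `|r j|)].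

Lemma all_monomials_sub (s : seq (T -> R)) (Q1 Q2 : (T -> R) -> Prop) :
  (forall h, Q1 h -> Q2 h) -> all_monomials s Q1 -> all_monomials s Q2.
Proof.
elim: s Q1 Q2 => [|g s IH] Q1 Q2 Q12 /=; first exact: Q12.
move=> [H0 H1 H2]; split; [move: H0|move: H1|move: H2]; apply: IH => // h;
  exact: Q12.
Qed.

Lemma lacunary_subsequence (f : nat -> T -> R) (delta eta : R) :
  (forall k, bmeas (f k)) -> (forall k x, `|f k x| <= 1) ->
  (forall h, bmeas h -> E (fun x => f k x * h x) @[k --> \oo] --> (0 : R)) ->
  (forall k, delta <= E (fun x => f k x ^+ 2)) -> 0 < eta ->
  exists m : nat -> nat, (forall i j, (i < j)%N -> (m i < m j)%N) /\
  exists L, [/\ linear_bmeas L, delta <= L (fun=> 1) &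
    small_products (fun i => f (m i)) L eta].
Proof.
move=> bf f1 f0 fdelta eta0.
have [U [UU ooU]] := ultraFilterLemma eventually_filter.
have eps0 n : 0 < eta / 4 ^+ n.+1 by rewrite divr_gt0// exprn_gt0.
have /choice[next nextP] (ns : nat * seq nat) :=
  next_index P f bf f1 f0 U UU ooU (eta / 4 ^+ ns.1.+1) ns.2 (eps0 ns.1).
(* [sel n] lists the first [n] chosen indices with the latest at the head, matching
   [rev (iota 0 n)]. *)
pose sel := fix sel n := if n is n'.+1 then next (n', sel n') :: sel n' else [::].
pose m n := next (n, sel n).
have selE n : sel n = [seq m j | j <- rev (iota 0 n)].
  by elim: n => [//|n IH]; rewrite -[in RHS]addn1 iotaD rev_cat/= add0n -IH.
exists m; split.
  move=> i j ij; have [+ _] := nextP (j, sel j); apply; rewrite /= selE.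
  by apply: map_f; rewrite mem_rev mem_iota.
have [LD LZ] : linear_bmeas (limsq P f U).
  by split=> [u v bu bv|c u bu]; [exact: limsqD|exact: limsqZ].
exists (limsq P f U); split => //.
  apply: limsq_ge => [//|//||k].
    exact: bmeas_cst.
  by under eq_fun do rewrite mulr1.
move=> n p q r; have [_] := nextP (n, sel n); rewrite -/(m n) /= selE -map_comp => H.
split.
- apply: (all_monomials_qprod n (fun u => E (fun x => f (m n) x * u x))) => //.
    exact: linear_bmeas_Ex.
  by apply: all_monomials_sub H => h [].
- apply: (all_monomials_qprod n (fun u => limsq P f U (fun x => f (m n) x * u x))) => //.
    split=> [u v bu bv|c u bu].
      rewrite -LD; [|exact: bmeasM..].
      by congr limsq; apply/funext => x; rewrite mulrDr.
    rewrite -LZ; last exact: bmeasM.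
    by congr limsq; apply/funext => x; rewrite mulrCA.
  by apply: all_monomials_sub H => h [].
- apply: (all_monomials_qprod n
    (fun u => E (fun x => f (m n) x ^+ 2 * u x) - limsq P f U u)) => //.
    have [ED EZ] := linear_bmeas_Ex _ (bmeasX 2 (bf (m n))).
    by split=> [u v bu bv|c u bu]; rewrite ?ED ?LD ?EZ ?LZ//; ring.
  by apply: all_monomials_sub H => h [].
Qed.

End quadratic_products.

(** * Riesz products of an almost orthogonal system *)

Section riesz_products.
Context {d : measure_display} {T : measurableType d} {R : realType}.
Variable P : probability T R.
Local Notation E := (Ex P).
Variables (g : nat -> T -> R) (L : (T -> R) -> R) (delta eta : R).
Hypothesis bg : forall k, bmeas (g k).
Hypothesis g1 : forall k x, `|g k x| <= 1.
Hypothesis linL : linear_bmeas L.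
Hypothesis L1 : delta <= L (fun=> 1).
Hypothesis eta0 : 0 <= eta.
Hypothesis eta1 : eta <= 1.
Hypothesis gL : small_products P g L eta.

Let e n : R := eta / 2 ^+ n.+2.

Lemma sum_e i N : \sum_(i <= n < N) e n <= eta / 2 ^+ i.+1.
Proof.
have [iN|Ni] := leqP i N; last first.
  by rewrite big_geq ?divr_ge0 ?exprn_ge0// ltnW.
suff : \sum_(i <= n < N) e n = eta / 2 ^+ i.+1 - eta / 2 ^+ N.+1.
  by move=> ->; rewrite gerBl divr_ge0// exprn_ge0.
pose F n := - (eta / 2 ^+ n.+1).
rewrite (eq_bigr (fun n => F n.+1 - F n)) ?telescope_sumr// => [|n _].
  by rewrite /F opprK addrC.
by rewrite /F opprK /e !(exprS _ n.+1); field; rewrite expf_neq0.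
Qed.

(** The [n] factors cost at most 2^n relative to the [c j], and 2^n / 4^(n+1) = 1 / 2^(n+2) is the
    factor in [e n]. *)
Lemma e_weight (w : nat -> R) c n : (forall j, 0 <= w j <= 2 * c j) -> (forall j, 0 <= c j) ->
  eta / 4 ^+ n.+1 * \prod_(j < n) w j <= e n * \prod_(j < n) c j.
Proof.
move=> w2 c0.
have -> : e n = eta / 4 ^+ n.+1 * 2 ^+ n.
  rewrite /e (_ : 4 = 2 * 2); last by ring.
  by rewrite exprMn !exprS; field; rewrite expf_neq0.
rewrite -[leRHS]mulrA ler_wpM2l ?divr_ge0 ?exprn_ge0//.
rewrite -[n in 2 ^+ n]card_ord -prodr_const -big_split/=.
by apply: ler_prod => j _; exact: w2.
Qed.

Definition rprod (p q : nat -> R) n : T -> R :=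
  fun x => \prod_(j < n) (p j + q j * g j x).

Lemma bmeas_rprod p q n : bmeas (rprod p q n).
Proof. by rewrite /rprod; solve_bmeas. Qed.

Lemma rprodE p q n : rprod p q n = qprod g p q (fun=> 0) n.
Proof.
by apply/funext => x; apply: eq_bigr => j _; rewrite mul0r addr0.
Qed.

Lemma rprodS p q n :
  rprod p q n.+1 = fun x => p n * rprod p q n x + q n * (g n x * rprod p q n x).
Proof. by apply/funext => x; rewrite /rprod big_ord_recr/=; ring. Qed.

Lemma small_rprod p q n : (forall j, `|q j| <= p j) ->
  [/\ `|E (fun x => g n x * rprod p q n x)| <= e n * \prod_(j < n) p j,
      `|L (fun x => g n x * rprod p q n x)| <= e n * \prod_(j < n) p j &
      `|E (fun x => g n x ^+ 2 * rprod p q n x) - L (rprod p q n)| <=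
        e n * \prod_(j < n) p j].
Proof.
move=> qp; have [H1 H2 H3] := gL n p q (fun=> 0); rewrite rprodE.
have p0 j : 0 <= p j by exact: le_trans (qp j).
have H : eta / 4 ^+ n.+1 * \prod_(j < n) (`|p j| + `|q j| + `|0 : R|) <=
    e n * \prod_(j < n) p j.
  apply: (e_weight (fun j => `|p j| + `|q j| + `|0 : R|)) => // j.
  rewrite normr0 addr0 addr_ge0//= ger0_norm//.
  by rewrite (_ : 2 = 1 + 1) ?mulrDl ?mul1r ?lerD2l.
by split; apply: le_trans H.
Qed.

(** The factor of index n multiplies the expectation by [p n], up to an error [e n] relative to the
    product of the [p j]; these errors add up to at most eta / 2 <= 1 / 2. *)
Lemma Ex_rprod_le p q N : (forall j, `|q j| <= p j) ->
  E (rprod p q N) <= 2 * \prod_(j < N) p j.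
Proof.
move=> qp; have p0 j : 0 <= p j by exact: le_trans (qp j).
suff : E (rprod p q N) <= (1 + \sum_(0 <= n < N) e n) * \prod_(j < N) p j.
  move=> /le_trans; apply; rewrite ler_wpM2r ?prodr_ge0//.
  move: eta1 (sum_e 0 N); rewrite expr1; move: (\sum_(_ <= _ < _) _) => s.
  by lra.
elim: N => [|N IH].
  rewrite big_geq// big_ord0 addr0 mul1r /rprod.
  by under eq_fun do rewrite big_ord0; rewrite Ex_cst.
have bN := bmeas_rprod p q N; have bgN := bg N.
rewrite rprodS ExD; [|solve_bmeas..].
rewrite !ExZ; [|solve_bmeas..].
rewrite big_nat_recr//= big_ord_recr/= addrA mulrDl lerD//.
  by rewrite mulrCA mulrC mulrA ler_wpM2r// mulrC.
have [H _ _] := small_rprod p q N qp.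
rewrite (le_trans (ler_norm _))// normrM mulrC mulrA.
by apply: ler_pM.
Qed.

(** * Correlation of the system with its Riesz products *)

Section riesz_lower.
Variables (x : nat -> R).
Hypothesis x1 : forall j, `|x j| <= 1.
Local Notation G := (rprod (fun=> 1) x).

(** The empty product contributes L 1 >= delta, and almost orthogonality under [L] lets each new
    factor cost at most [e k]. *)
Lemma L_riesz n : delta - \sum_(0 <= k < n) e k <= L (G n).
Proof.
have [LD LZ] := linL.
elim: n => [|n IH].
  rewrite big_geq// subr0 /rprod.
  by under [X in L X]eq_fun do rewrite big_ord0.
have bn := bmeas_rprod (fun=> 1) x n; have bgn := bg n.
rewrite rprodS LD; [|solve_bmeas..].
rewrite !LZ; [|solve_bmeas..].
rewrite big_nat_recr//= mul1r opprD addrA lerD//.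
have [_ H _] := small_rprod _ _ n x1.
move: H; rewrite big1_eq mulr1 => H.
rewrite lerNl (le_trans (ler_norm _))// normrN normrM.
by rewrite (le_trans _ H)// ler_piMl.
Qed.

(** Passing from [E] to [L] costs [e i], so with [L_riesz] the total loss is the sum of [e k] over k
    <= i, below eta. *)
Lemma Ex_sq_riesz i : delta - eta <= E (fun w => g i w ^+ 2 * G i w).
Proof.
have [_ _] := small_rprod _ _ i x1; rewrite big1_eq mulr1.
have := L_riesz i; have := sum_e 0 i.+1.
rewrite big_nat_recr//= expr1 ler_norml => H1 H2 /andP[H3 _].
move: eta0 H1 H2 H3; move: (\sum_(_ <= _ < _) _) (e i) => s ei.
by lra.
Qed.

Lemma Ex_g_g_riesz i n : (i < n)%N ->
  `|E (fun w => g n w * (g i w * G n w))| <= e n.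
Proof.
move=> ilt.
pose p (j : nat) : R := if j == i then 0 else 1.
pose q (j : nat) : R := if j == i then 1 else x j.
pose r (j : nat) : R := if j == i then x j else 0.
have [H _ _] := gL n p q r.
rewrite (_ : (fun w => _) = (fun w => g n w * qprod g p q r n w)); last first.
  apply/funext => w; congr (_ * _); rewrite /rprod /qprod.
  rewrite (bigD1 (Ordinal ilt))//= [RHS](bigD1 (Ordinal ilt))//= /p /q /r eqxx.
  rewrite mulrA; congr (_ * _); first by ring.
  apply: eq_bigr => j jn; rewrite (_ : (j == i :> nat) = false); first by ring.
  by apply: contraNF jn => /eqP ji; apply/eqP/val_inj.
apply: (le_trans H).
have w2 (j : nat) : 0 <= `|p j| + `|q j| + `|r j| <= 2 * 1.
  rewrite !addr_ge0//= mulr1 /p /q /r.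
  by case: ifP => _; rewrite !(normr0, normr1); have := x1 j; lra.
by have := e_weight _ _ n w2 (fun=> ler01); rewrite big1_eq mulr1.
Qed.

(** Induction on [N]: the factor of index [i] creates the main term x_i E[g_i^2 G_i], while
    E[g_i G_i] and every later factor enter only as errors [e n]. *)
Lemma Ex_g_riesz a i N : (i < N)%N -> 0 <= a * x i ->
  (delta - eta) * (a * x i) - `|a| * \sum_(i <= n < N) e n <=
  a * E (fun w => g i w * G N w).
Proof.
move=> + ax; elim: N => [//|N IH].
have bN := bmeas_rprod (fun=> 1) x N; have bgN := bg N; have bgi := bg i.
rewrite rprodS ltnS => iN.
rewrite (_ : (fun w => _) = (fun w => g i w * G N w + x N * (g N w * (g i w * G N w)))); last first.
  by apply/funext => w; ring.
rewrite ExD; [|solve_bmeas..].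
rewrite !ExZ; [|solve_bmeas..].
rewrite big_nat_recr//= mulrDr opprD addrA mulrDr.
move: iN; rewrite leq_eqVlt => /predU1P[iN|iN]; last first.
  rewrite lerD ?IH// lerNl (le_trans (ler_norm _))// normrN !normrM.
  rewrite ler_wpM2l//.
  by rewrite (le_trans _ (Ex_g_g_riesz _ _ iN))// ler_piMl.
rewrite -{N}iN in bN bgN IH *.
rewrite big_geq// mulr0 subr0 addrC lerD//; last first.
  rewrite (_ : (fun w => _) = (fun w => g i w ^+ 2 * G i w)); last first.
    by apply/funext => w; ring.
  by rewrite [leRHS]mulrA mulrC ler_wpM2l// Ex_sq_riesz.
have [H _ _] := small_rprod _ _ i x1; move: H; rewrite big1_eq mulr1 => H.
by rewrite lerNl (le_trans (ler_norm _))// normrN normrM ler_wpM2l.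
Qed.

(** Summation of [Ex_g_riesz] over [i]: the tail of [e] from [i] on is at most eta / 2^(i+1), and
    these bounds again sum to at most [eta]. *)
Lemma Ex_sum_riesz (a : nat -> R) M N : (forall i, 0 <= a i * x i) ->
  (forall i, (i < N)%N -> `|a i| <= M) -> 0 <= M ->
  (delta - eta) * \sum_(i < N) a i * x i - M * eta <=
  E (fun w => (\sum_(i < N) a i * g i w) * G N w).
Proof.
move=> ax aM M0; have bN := bmeas_rprod (fun=> 1) x N.
rewrite (_ : (fun w => _) = (fun w => \sum_(i < N) a i * (g i w * G N w))); last first.
  by apply/funext => w; rewrite mulr_suml; apply: eq_bigr => i _; rewrite mulrA.
rewrite Ex_sum => [|i]; last by have := bg i; move=> ?; solve_bmeas.
rewrite (@le_trans _ _ (\sum_(i < N) ((delta - eta) * (a i * x i) -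
    `|a i| * \sum_(i <= n < N) e n)))//; last first.
  apply: ler_sum => i _; rewrite ExZ; first exact: Ex_g_riesz.
  by apply: bmeasM.
rewrite sumrB -mulr_sumr lerD2l lerN2.
rewrite (@le_trans _ _ (\sum_(i < N) M * (eta / 2 ^+ i.+1)))//.
  apply: ler_sum => i _; apply: ler_pM => //; first last.
  - exact: sum_e.
  - exact: aM.
  by apply: sumr_ge0 => n _; rewrite divr_ge0 ?exprn_ge0.
rewrite -mulr_sumr ler_wpM2l//.
suff -> : \sum_(i < N) eta / 2 ^+ i.+1 = eta - eta / 2 ^+ N.
  by rewrite gerBl divr_ge0 ?exprn_ge0.
elim: N {aM bN} => [|N IH]; first by rewrite big_ord0 expr0; field.
by rewrite big_ord_recr/= IH exprS; field; rewrite expf_neq0.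
Qed.

End riesz_lower.

End riesz_products.

(** * Moments *)

Section exponential_inequalities.
Context {R : realType}.
Implicit Types a s u t M : R.

(* Average the tangent-line bounds [e^(+-a) >= e^(as) (1 +- a - as)]. *)
Lemma expR_convex_bound a s : -1 <= s <= 1 ->
  expR (a * s) <=
  (expR a + expR (- a)) / 2 + (expR a - expR (- a)) / 2 * s.
Proof.
move=> /andP[s1 s2]; have e0 := expR_gt0 (a * s).
have H b : expR (a * s) * (1 + (b - a * s)) <= expR b.
  by rewrite -{2}(subrK (a * s) b) [leRHS]expRD mulrC ler_wpM2r ?expR_ge1Dx// ltW.
have := H a; have := H (- a); move: (expR _) (expR a) (expR (- a)) e0 => z x y z0 Hy Hx.
have H1 : 0 <= (1 - s) * (y - z * (1 + (- a - a * s))) by rewrite mulr_ge0 ?subr_ge0.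
have H2 : 0 <= (1 + s) * (x - z * (1 + (a - a * s))).
  by rewrite mulr_ge0 ?subr_ge0//; lra.
by lra.
Qed.

(** For a^2 > 1/2 both exponents are at most |a| <= 2 a^2. Otherwise e^a <= 1 / (1 - a) and e^(-a)
    <= 1 / (1 + a) average to 1 / (1 - a^2) <= 1 + 2 a^2. *)
Lemma cosh_le a : (expR a + expR (- a)) / 2 <= expR (2 * a ^+ 2).
Proof.
have [a2|a2] := lerP (a ^+ 2) (1 / 2); last first.
  have Ha : `|a| <= 2 * a ^+ 2.
    have := normr_ge0 a; have : `|a| ^+ 2 = a ^+ 2 by rewrite real_normK ?num_real.
    by move: `|a| => b; nra.
  have H1 : expR a <= expR (2 * a ^+ 2).
    by rewrite ler_expR (le_trans _ Ha)// ler_norm.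
  have H2 : expR (- a) <= expR (2 * a ^+ 2).
    by rewrite ler_expR (le_trans _ Ha)// -normrN ler_norm.
  by lra.
have Hp := expR_ge1Dx a; have Hm := expR_ge1Dx (- a).
have pm : expR a * expR (- a) = 1 by rewrite -expRD subrr expR0.
have Hs := expR_ge1Dx (2 * a ^+ 2).
have a1 : -1 < a /\ a < 1 by split; nra.
rewrite (le_trans _ Hs)//.
move: (expR a) (expR (- a)) Hp Hm pm (expR_gt0 a) (expR_gt0 (- a)) => p m Hp Hm pm p0 m0.
have p1 : p * (1 - a) <= 1 by rewrite -pm ler_pM2l//; lra.
have m1 : m * (1 + a) <= 1 by rewrite -pm mulrC ler_pM2r//; lra.
have p2 : p * (1 - a ^+ 2) <= 1 + a.
  by rewrite -[1 - _](_ : (1 - a) * (1 + a) = _) ?mulrA; [nra|ring].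
have m2 : m * (1 - a ^+ 2) <= 1 - a.
  by rewrite -[1 - _](_ : (1 + a) * (1 - a) = _) ?mulrA; [nra|ring].
by have := sqr_ge0 a; nra.
Qed.

(** The inequality u / c <= e^(u / c) raised to the power [t]. *)
Lemma powR_le_expR t u c : 1 <= t -> 0 <= u -> 0 < c ->
  u `^ t <= c `^ t * expR (t / c * u).
Proof.
move=> t1 u0 c0; have t0 : 0 <= t by rewrite (le_trans _ t1).
rewrite (_ : t / c * u = u / c * t); last by ring.
rewrite expRM -powRM ?expR_ge0 ?(ltW c0)//; apply: ge0_ler_powR => //.
- by rewrite nnegrE mulr_ge0 ?expR_ge0// ltW.
- rewrite mulrC -ler_pdivrMr// (le_trans _ (expR_ge1Dx _))//.
  by rewrite lerDr.
Qed.

(** With s = 1 / (t - 1) the conjugate exponent is 1 + s = t s. If u <= e^t then u^s <= e^(t s);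
    beyond e^t, s <= 1 gives the extra factor u / e^t. The cut at e^t suits a second moment of order
    e^t. *)
Lemma powR_conj_le t u : 2 <= t -> 0 <= u ->
  u `^ (t / (t - 1)) <= expR (t / (t - 1)) * (u + u ^+ 2 / expR t).
Proof.
move=> t2; rewrite le_eqVlt => /predU1P[<-|u0].
  have s0 : 0 < t / (t - 1) by rewrite divr_gt0//; lra.
  by rewrite powR0 ?gt_eqF// mulr_ge0 ?expR_ge0// expr0n/= mul0r addr0.
have t1 : 0 < t - 1 by lra.
set s := (t - 1)^-1.
have s0 : 0 <= s by rewrite invr_ge0 ltW.
have s1 : s <= 1 by rewrite invf_le1//; lra.
have tE : t / (t - 1) = 1 + s by rewrite /s; field; lra.
have tE' : t * s = 1 + s by rewrite -tE.
have M0 := expR_gt0 t.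
rewrite tE powRD ?(gt_eqF u0) ?implybT// powRr1 ?(ltW u0)//.
rewrite (_ : u + _ = u * (1 + u / expR t)); last by field; rewrite gt_eqF.
rewrite mulrCA ler_wpM2l ?(ltW u0)// -tE' expRM.
have [uM|Mu] := leP u (expR t).
  rewrite (@le_trans _ _ (expR t `^ s))//.
    by rewrite ge0_ler_powR// nnegrE ltW.
  by rewrite ler_peMr ?powR_ge0// lerDl divr_ge0// ltW.
rewrite -{1}(divfK (lt0r_neq0 M0) u) mulrC powRM ?divr_ge0 ?(ltW u0) ?(ltW M0)//.
rewrite ler_wpM2l ?powR_ge0//.
have uM1 : 1 <= u / expR t by rewrite ler_pdivlMr// mul1r ltW.
rewrite (@le_trans _ _ ((u / expR t) `^ 1))//; first by rewrite ler_powR.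
by rewrite powRr1 ?lerDr// (le_trans _ uM1).
Qed.

End exponential_inequalities.

(** * Subgaussian upper bound and dual norms of Riesz products *)

Section moments.
Context {d : measure_display} {T : measurableType d} {R : realType}.
Variable P : probability T R.
Local Notation E := (Ex P).

Lemma Lnorm_Ex (u : T -> R) (t : R) : 0 < t -> bmeas u ->
  'N[P]_(t%:E)[EFin \o u]%E = (E (fun x => `|u x| `^ t) `^ t^-1)%:E.
Proof.
move=> t0 bu; rewrite unlock -poweR_EFin EFin_Ex//.
by apply: bmeas_powR => //; exact: ltW.
Qed.

Lemma Ex_hoelder (u v : T -> R) (t s : R) : 0 < t -> 0 < s -> t^-1 + s^-1 = 1 ->
  bmeas u -> bmeas v ->
  E (fun x => u x * v x) <=
  E (fun x => `|u x| `^ t) `^ t^-1 * E (fun x => `|v x| `^ s) `^ s^-1.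
Proof.
move=> t0 s0 ts bu bv.
rewrite (le_trans (ler_norm _))// (le_trans (ler_norm_Ex P (bmeasM bu bv)))//.
have := hoelder P bu.1 bv.1 t0 s0 ts.
rewrite Lnorm1 (Lnorm_Ex _ _ t0 bu) (Lnorm_Ex _ _ s0 bv) -EFinM.
by rewrite -lee_fin EFin_Ex//; apply: bmeas_norm; exact: bmeasM.
Qed.

Variables (g : nat -> T -> R) (L : (T -> R) -> R) (eta : R).
Hypothesis bg : forall k, bmeas (g k).
Hypothesis g1 : forall k x, `|g k x| <= 1.
Hypothesis eta0 : 0 <= eta.
Hypothesis eta1 : eta <= 1.
Hypothesis gL : small_products P g L eta.

Definition gsum (a : nat -> R) N : T -> R := fun x => \sum_(i < N) a i * g i x.

Lemma bmeas_gsum a N : bmeas (gsum a N).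
Proof. by rewrite /gsum; solve_bmeas. Qed.

(** The chord bound for the exponential dominates the integrand by a Riesz product with p = cosh a_i
    and q = sinh a_i, to which [Ex_rprod_le] and then [cosh_le] apply. *)
Lemma Ex_expR_gsum a N :
  E (fun x => expR (gsum a N x)) <= 2 * expR (2 * \sum_(i < N) a i ^+ 2).
Proof.
pose p i := (expR (a i) + expR (- a i)) / 2.
pose q i := (expR (a i) - expR (- a i)) / 2.
have qp i : `|q i| <= p i.
  have := expR_gt0 (a i); have := expR_gt0 (- a i); rewrite /p /q ler_norml => *.
  by apply/andP; split; lra.
have b1 := bmeas_gsum a N; have b2 := bmeas_rprod g bg p q N.
rewrite (@le_trans _ _ (E (rprod g p q N)))//.
  apply: ler_Ex => //; first solve_bmeas.
  move=> x; rewrite /gsum expR_sum; apply: ler_prod => i _.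
  by rewrite expR_ge0/= expR_convex_bound// -ler_norml.
rewrite (le_trans (Ex_rprod_le P g L eta bg eta0 eta1 gL p q N qp))//.
rewrite ler_wpM2l// mulr_sumr expR_sum; apply: ler_prod => i _.
by rewrite cosh_le divr_ge0 ?addr_ge0 ?expR_ge0.
Qed.

(** Chosen so that 4 e^(2t) <= [subg_const] to the power t for t >= 1. *)
Definition subg_const : R := 4 * expR 2.

Lemma Ex_powR_gsum a N t : 1 <= t -> E (fun x => `|gsum a N x| `^ t) <=
  (subg_const * Num.sqrt t * Num.sqrt (\sum_(i < N) a i ^+ 2)) `^ t.
Proof.
move=> t1; have t0 : 0 < t by rewrite (lt_le_trans ltr01).
have : 0 <= \sum_(i < N) a i ^+ 2 by apply: sumr_ge0 => i _; exact: sqr_ge0.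
rewrite le_eqVlt => /predU1P[a0|a0].
  rewrite -a0 sqrtr0 mulr0.
  have {}a0 (i : 'I_N) : a i = 0.
    apply/eqP; rewrite -sqrf_eq0; apply/eqP.
    by apply: (psumr_eq0P _ (esym a0)) => // j _; exact: sqr_ge0.
  rewrite (_ : (fun x => _) = fun=> 0 `^ t) ?Ex_cst//.
  apply/funext => x; rewrite /gsum big1 ?normr0// => i _.
  by rewrite a0 mul0r.
set s := Num.sqrt (\sum_(i < N) _).
have s0 : 0 < s by rewrite sqrtr_gt0.
(* At this scale (t / c)^2 times the sum of squares equals t, so both exponential moments below are
   at most 2 e^(2t). *)
set c := Num.sqrt t * s.
have c0 : 0 < c by rewrite mulr_gt0// sqrtr_gt0.
have bS := bmeas_gsum a N.
have bexp b : bmeas (fun x => expR (gsum (fun i => b * a i) N x)).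
  by have bb := bmeas_gsum (fun i => b * a i) N; solve_bmeas.
have gsumZ b x : gsum (fun i => b * a i) N x = b * gsum a N x.
  by rewrite /gsum mulr_sumr; apply: eq_bigr => i _; rewrite mulrA.
have bb := bmeasD (bexp (t / c)) (bexp (- (t / c))).
apply: (@le_trans _ _ (E (fun x => c `^ t * (expR (gsum (fun i => (t / c) * a i) N x)
   + expR (gsum (fun i => - (t / c) * a i) N x))))).
  apply: ler_Ex => [||x].
  - by apply: bmeas_powR => //; exact: ltW.
  - exact: bmeasZ.
  rewrite (le_trans (powR_le_expR _ _ _ t1 (normr_ge0 _) c0))//.
  rewrite ler_wpM2l ?powR_ge0// !gsumZ.
  have [S0|S0] := leP 0 (gsum a N x).
    by rewrite (ger0_norm S0) lerDl expR_ge0.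
  by rewrite (ltr0_norm S0) mulrN mulNr lerDr expR_ge0.
rewrite ExZ// ExD//.
have mgf b : b ^+ 2 = (t / c) ^+ 2 ->
    E (fun x => expR (gsum (fun i => b * a i) N x)) <= 2 * expR (2 * t).
  move=> bE; rewrite (le_trans (Ex_expR_gsum _ _))//.
  under eq_bigr do rewrite exprMn bE.
  rewrite -mulr_sumr -[X in (t / c) ^+ 2 * X]sqr_sqrtr ?(ltW a0)// -/s.
  rewrite (_ : (t / c) ^+ 2 * s ^+ 2 = t)//.
  rewrite -exprMn /c.
  have : Num.sqrt t ^+ 2 = t by rewrite sqr_sqrtr// ltW.
  have := sqrtr_gt0 t; rewrite t0; move: (Num.sqrt t) => z z0 zt.
  by rewrite -zt; field; rewrite !gt_eqF.
rewrite -mulrA -/c powRM ?(ltW c0)//; last by rewrite mulr_ge0 ?expR_ge0.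
rewrite mulrC ler_wpM2r ?powR_ge0//.
apply: (@le_trans _ _ (4 * expR (2 * t))).
  by have := mgf (t / c) erefl; have := mgf (- (t / c)) (sqrrN _); lra.
rewrite powRM ?expR_ge0// expRM ler_wpM2r ?powR_ge0//.
by rewrite -{1}[4]powRr1// ler_powR ?ler1n.
Qed.

Lemma Lnorm_gsum a N t : 1 <= t -> ('N[P]_(t%:E)[EFin \o gsum a N] <=
  (subg_const * Num.sqrt t * Num.sqrt (\sum_(i < N) a i ^+ 2))%:E)%E.
Proof.
move=> t1; have t0 : 0 < t by rewrite (lt_le_trans ltr01).
have c0 : 0 <= subg_const * Num.sqrt t * Num.sqrt (\sum_(i < N) a i ^+ 2).
  by rewrite !mulr_ge0 ?sqrtr_ge0// expR_ge0.
rewrite Lnorm_Ex// ?lee_fin; last exact: bmeas_gsum.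
rewrite -[leRHS]powRr1// -(mulfV (lt0r_neq0 t0)) powRrM.
rewrite ge0_ler_powR ?invr_ge0 ?(ltW t0) ?nnegrE ?powR_ge0//; last exact: Ex_powR_gsum.
by apply: Ex_ge0 => x; exact: powR_ge0.
Qed.

(** [powR_conj_le] interpolates between E G <= 2 and E G^2 <= 2 e^t, giving e^s * 4 for the moment
    of order s = t / (t - 1); its root of order s is at most 4 e. *)
Lemma Lnorm_riesz (x : nat -> R) N t : 2 <= t -> (forall j, `|x j| <= 1) ->
  \sum_(j < N) x j ^+ 2 <= t ->
  E (fun w => `|rprod g (fun=> 1) x N w| `^ (t / (t - 1))) `^ (t / (t - 1))^-1
    <= 4 * expR 1.
Proof.
move=> t2 x1 xt; set G := rprod _ _ _ _; set s := t / (t - 1).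
have s1 : 1 <= s by rewrite ler_pdivlMr; lra.
have s0 : 0 < s by rewrite (lt_le_trans ltr01).
have G0 w : 0 <= G w.
  apply: prodr_ge0 => j _; rewrite -[X in 0 <= X]opprK lerNr oppr0.
  have : `|x j * g j w| <= 1 by rewrite normrM mulr_ile1.
  by rewrite ler_norml; lra.
have bG : bmeas G by exact: bmeas_rprod.
have EG : E G <= 2.
  have := Ex_rprod_le P g L eta bg eta0 eta1 gL (fun=> 1) x N x1.
  by rewrite big1_eq mulr1.
have EG2 : E (fun w => G w ^+ 2) <= 2 * expR t.
  (* Since g_j^2 <= 1, (1 + x_j g_j)^2 <= (1 + x_j^2) + 2 x_j g_j, so G^2 is dominated by another
     Riesz product. *)
  pose p j := 1 + x j ^+ 2; pose q j := 2 * x j.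
  have qp j : `|q j| <= p j.
    have := sqr_ge0 (x j - 1); have := sqr_ge0 (x j + 1).
    by rewrite /q /p ler_norml => H1 H2; apply/andP; split; lra.
  have bpq : bmeas (rprod g p q N) by exact: bmeas_rprod.
  rewrite (@le_trans _ _ (E (rprod g p q N)))//.
    apply: ler_Ex => //; first exact: bmeasX.
    move=> w; rewrite /G /rprod -prodrXl; apply: ler_prod => j _.
    have g2 : g j w ^+ 2 <= 1 by rewrite -real_normK ?num_real// expr_le1.
    have := ler_wpM2l (sqr_ge0 (x j)) g2.
    by rewrite sqr_ge0/= /p /q; lra.
  rewrite (le_trans (Ex_rprod_le P g L eta bg eta0 eta1 gL p q N qp))//.
  rewrite ler_wpM2l// (@le_trans _ _ (expR (\sum_(j < N) x j ^+ 2)))//; last first.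
    by rewrite ler_expR.
  rewrite expR_sum; apply: ler_prod => j _.
  by rewrite expR_ge1Dx addr_ge0 ?sqr_ge0.
have H : E (fun w => `|G w| `^ s) <= expR s * 4.
  rewrite (@le_trans _ _ (E (fun w => expR s * (G w + (expR t)^-1 * G w ^+ 2))))//.
    apply: ler_Ex => [||w].
    - by apply: bmeas_powR => //; exact: ltW.
    - by solve_bmeas.
    - by rewrite ger0_norm// [_^-1 * _]mulrC; exact: powR_conj_le.
  rewrite ExZ; last by solve_bmeas.
  rewrite ler_wpM2l ?expR_ge0// ExD//; last by solve_bmeas.
  rewrite ExZ; last by solve_bmeas.
  have : (expR t)^-1 * E (fun w => G w ^+ 2) <= 2.
    by rewrite mulrC ler_pdivrMr// expR_gt0.
  by move: (_^-1 * _) => y; lra.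
rewrite (@le_trans _ _ ((expR s * 4) `^ s^-1))//.
  rewrite ge0_ler_powR ?nnegrE ?mulr_ge0 ?expR_ge0 ?invr_ge0 ?(ltW s0)//.
  by apply: Ex_ge0 => w; exact: powR_ge0.
rewrite powRM ?expR_ge0// -expRM mulfV ?gt_eqF// mulrC ler_wpM2r ?expR_ge0//.
by rewrite -[leRHS]powRr1// ler_powR ?invf_le1 ?ler1n.
Qed.

End moments.

(** * Lower bound for finite sums *)

Section dual_witness.
Context {R : realType}.
Implicit Types (a b c x : nat -> R) (t : R).

Lemma continuous_sum_min a N t : continuous
  (fun y : R => \sum_(i < N) Num.min (a i ^+ 2) (y ^+ 2) - t * y ^+ 2).
Proof.
have sq : continuous (fun y : R => y ^+ 2) by exact: exprn_continuous.
move=> y; apply: cvgB; last by apply: cvgMr; exact: sq.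
elim: N => [|N IH].
  by under eq_fun do rewrite big_ord0; rewrite big_ord0; exact: cvg_cst.
under eq_fun do rewrite big_ord_recr/=.
rewrite big_ord_recr/=; apply: cvgD => //.
exact: (@continuous_min R R (fun=> a N ^+ 2) (fun z => z ^+ 2) y (cvg_cst _) (sq y)).
Qed.

Lemma le_sum1 (F : nat -> R) N i : (forall j, 0 <= F j) -> (i < N)%N ->
  F i <= \sum_(j < N) F j.
Proof.
move=> F0 iN; rewrite (bigD1 (Ordinal iN))//= lerDl; apply: sumr_ge0 => j _.
exact: F0.
Qed.

(** Intermediate values: for y below every nonzero |a_i| the sum is y^2 times the size of the
    support, which exceeds t; for y above the sum of all |a_i| it is at most y^2 <= t y^2. *)
Lemma exists_threshold a N t : 1 <= t -> t < \sum_(i < N) Num.sg (a i) ^+ 2 ->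
  exists2 y, 0 < y & \sum_(i < N) Num.min (a i ^+ 2) (y ^+ 2) = t * y ^+ 2.
Proof.
move=> t1 ta.
have [m m0 ma] : exists2 m, 0 < m & forall i, (i < N)%N -> a i != 0 -> m <= `|a i|.
  elim: N {ta} => [|N [m m0 ma]]; first by exists 1.
  have [aN0|aN0] := eqVneq (a N) 0.
    exists m => // i; rewrite ltnS leq_eqVlt => /predU1P[->|]; last exact: ma.
    by rewrite aN0 eqxx.
  exists (Num.min m `|a N|); first by rewrite lt_min m0 normr_gt0.
  move=> i; rewrite ltnS leq_eqVlt => /predU1P[->|iN] ai; rewrite ge_min.
    by rewrite lexx orbT.
  by rewrite ma.
pose M := m + \sum_(i < N) `|a i|.
have S0 : 0 <= \sum_(i < N) `|a i| by apply: sumr_ge0.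
have mM : m <= M by rewrite lerDl.
pose H y : R := \sum_(i < N) Num.min (a i ^+ 2) (y ^+ 2) - t * y ^+ 2.
have Hm : 0 <= H m.
  rewrite /H subr_ge0 (@le_trans _ _ ((\sum_(i < N) Num.sg (a i) ^+ 2) * m ^+ 2))//.
    by rewrite ler_wpM2r ?sqr_ge0// ltW.
  rewrite mulr_suml ler_sum// => i _; rewrite sqr_sg le_min.
  have [->|ai] := eqVneq (a i) 0; first by rewrite mul0r !sqr_ge0.
  rewrite mul1r lexx andbT -[leRHS]real_normK ?num_real//.
  by rewrite lerXn2r ?nnegrE ?(ltW m0)// ma.
have HM : H M <= 0.
  rewrite /H subr_le0 (@le_trans _ _ (M ^+ 2))//; last first.
    by rewrite ler_peMl ?sqr_ge0.
  rewrite (@le_trans _ _ (\sum_(i < N) `|a i| * \sum_(j < N) `|a j|))//.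
    apply: ler_sum => i _; rewrite ge_min -real_normK ?num_real//.
    rewrite expr2 ler_wpM2l//=.
    exact: (le_sum1 (fun j => `|a j|)).
  rewrite -mulr_suml -expr2 lerXn2r// ?nnegrE ?addr_ge0 ?(ltW m0)//.
  by rewrite lerDr ltW.
have [||y] := @IVT R H m M 0 mM.
- by apply: continuous_subspaceT; exact: continuous_sum_min.
- by rewrite ge_min le_max HM Hm !orbT.
rewrite in_itv/= => /andP[my _] /eqP; rewrite subr_eq0 => /eqP Hy.
by exists y => //; exact: lt_le_trans my.
Qed.

(* [x] is the clipping of [a / y] to [-1, 1], where the threshold [y] is such that
   [\sum x_j^2 = t]; [b + c] splits [a] accordingly.  When [a] has at most [t]
   nonzero entries, there is no such [y], and [x] is the sign of [a]. *)
Lemma K12_dual_witness a N t : 1 <= t -> exists x b c,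
  [/\ forall j, `|x j| <= 1, \sum_(j < N) x j ^+ 2 <= t,
      forall j, 0 <= a j * x j, forall j, a j = b j + c j &
      (forall j, (j < N)%N -> `|a j| <= \sum_(i < N) a i * x i) /\
      \sum_(j < N) `|b j| + Num.sqrt t * Num.sqrt (\sum_(j < N) c j ^+ 2) <=
        \sum_(i < N) a i * x i].
Proof.
move=> t1; have t0 : 0 <= t by rewrite (le_trans _ t1).
have [ta|ta] := leP (\sum_(i < N) Num.sg (a i) ^+ 2) t.
  have E : \sum_(i < N) a i * Num.sg (a i) = \sum_(i < N) `|a i|.
    by apply: eq_bigr => i _; rewrite mulrC -normrEsg.
  exists (fun i => Num.sg (a i)), a, (fun=> 0); split => //.
  - by move=> j; rewrite normr_sg; case: eqP.
  - by move=> j; rewrite mulrC -normrEsg.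
  - by move=> j; rewrite addr0.
  split; first by move=> j jN; rewrite E; exact: (le_sum1 (fun j => `|a j|)).
  rewrite E [X in _ * Num.sqrt X]big1 ?sqrtr0 ?mulr0 ?addr0// => i _.
  by rewrite expr0n.
have [y y0 Hy] := exists_threshold _ _ _ t1 ta.
pose c i := Num.max (- y) (Num.min (a i) y).
pose b i := a i - c i.
(* The middle identity holds because b_i is nonzero only where clipping is active, and there c_i = y
   or -y with the sign of both a_i and b_i. *)
have cP i : [/\ `|c i| <= y, a i * c i = y * `|b i| + c i ^+ 2 &
    c i ^+ 2 = Num.min (a i ^+ 2) (y ^+ 2)].
  rewrite /b /c.
  have [ay|ya] := leP (a i) y; last first.
    rewrite max_r ?min_r//; [|by nra|by lra].
    by rewrite !gtr0_norm ?subr_gt0//; split=> //; ring.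
  have [ay'|ya'] := leP (- y) (a i).
    by rewrite subrr normr0 min_l ?ler_norml ?ay ?ay'//; [split=> //; ring|nra].
  rewrite min_r; last by nra.
  rewrite normrN (gtr0_norm y0) opprK ltr0_norm; last by lra.
  by split => //; ring.
have cE : \sum_(j < N) c j ^+ 2 = t * y ^+ 2.
  by rewrite -Hy; apply: eq_bigr => i _; have [] := cP i.
(* The term t * y is sqrt t times the l_2 norm of [c], by [cE]. *)
have aE : \sum_(i < N) a i * (c i / y) = \sum_(i < N) `|b i| + t * y.
  have -> : t * y = (\sum_(j < N) c j ^+ 2) / y.
    by rewrite cE; field; rewrite gt_eqF.
  rewrite mulr_suml -big_split/=; apply: eq_bigr => i _.
  have [_ H _] := cP i; rewrite mulrA H mulrDl; congr (_ + _).
  by field; rewrite gt_eqF.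
have b0 : 0 <= \sum_(i < N) `|b i| by apply: sumr_ge0.
exists (fun i => c i / y), b, c; split.
- move=> j; have [H _ _] := cP j.
  by rewrite normrM normfV (gtr0_norm y0) ler_pdivrMr// mul1r.
- under eq_bigr do rewrite expr_div_n.
  by rewrite -mulr_suml cE mulfK// expf_neq0// gt_eqF.
- move=> j; have [_ H _] := cP j.
  by rewrite mulrA H divr_ge0 ?(ltW y0)// addr_ge0 ?sqr_ge0// mulr_ge0// ltW.
- by move=> j; rewrite subrK.
split.
  move=> j jN; rewrite aE -(subrK (c j) (a j)) (le_trans (ler_normD _ _))// lerD//.
    exact: (le_sum1 (fun j => `|b j|)).
  have [H _ _] := cP j; rewrite (le_trans H)//.
  by rewrite ler_peMl// ltW.
rewrite aE cE sqrtrM// sqrtr_sqr (gtr0_norm y0) mulrA -expr2 sqr_sqrtr//.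
Qed.

End dual_witness.

(** * Comparison of first, second and fourth moments *)

Section first_moment.
Context {d : measure_display} {T : measurableType d} {R : realType}.
Variable P : probability T R.
Local Notation E := (Ex P).

Lemma Lnorm_le_bound (u : T -> R) (M t : R) : 0 < t -> 0 <= M -> bmeas u ->
  (forall x, `|u x| <= M) -> ('N[P]_(t%:E)[EFin \o u] <= M%:E)%E.
Proof.
move=> t0 M0 bu uM; rewrite Lnorm_Ex// lee_fin.
rewrite -[leRHS]powRr1// -(mulfV (lt0r_neq0 t0)) powRrM.
rewrite ge0_ler_powR ?invr_ge0 ?(ltW t0) ?nnegrE ?powR_ge0//.
  by apply: Ex_ge0 => x; exact: powR_ge0.
rewrite -[leRHS](Ex_cst P); apply: ler_Ex => [||x].
- by apply: bmeas_powR => //; exact: ltW.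
- exact: bmeas_cst.
- by rewrite ge0_ler_powR ?(ltW t0) ?nnegrE.
Qed.

(** Hoelder against the constant 1; t = 1 is separate because its conjugate exponent is infinite. *)
Lemma Ex_norm_le_Lnorm (u : T -> R) (t : R) : 1 <= t -> bmeas u ->
  E (fun x => `|u x|) <= E (fun x => `|u x| `^ t) `^ t^-1.
Proof.
rewrite le_eqVlt => /predU1P[<-|t1] bu.
  rewrite invr1 powRr1; last by apply: Ex_ge0 => x; exact: powR_ge0.
  by under [X in _ <= Ex _ X]eq_fun do rewrite powRr1//.
have t0 : 0 < t by lra.
have s0 : 0 < t / (t - 1) by rewrite divr_gt0//; lra.
have ts : t^-1 + (t / (t - 1))^-1 = 1 by rewrite invf_div; field; lra.
have := Ex_hoelder P _ _ _ _ t0 s0 ts (bmeas_norm bu) (bmeas_cst 1).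
under eq_fun do rewrite mulr1.
move=> /le_trans; apply.
rewrite (_ : (fun _ : T => `|1 : R| `^ _) = fun=> 1); last first.
  by apply/funext => x; rewrite normr1 powR1.
rewrite Ex_cst powR1 mulr1.
by under [X in Ex _ X `^ _ <= _]eq_fun do rewrite normr_id.
Qed.

(* Take expectations in [u^2 <= l |u| + u^4 / l^2] with [l^2 = 2 A B s^2]. *)
Lemma Ex_norm_ge (u : T -> R) (s A B : R) : 0 < A -> 0 < B -> 0 <= s -> bmeas u ->
  s ^+ 2 <= A * E (fun x => u x ^+ 2) -> E (fun x => u x ^+ 4) <= B * s ^+ 4 ->
  s <= 2 * A * Num.sqrt (2 * A * B) * E (fun x => `|u x|).
Proof.
move=> A0 B0 + bu; rewrite le_eqVlt => /predU1P[<-|s0] h2 h4.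
  rewrite mulr_ge0//; last by apply: Ex_ge0.
  by rewrite !mulr_ge0 ?sqrtr_ge0// ltW.
set q := Num.sqrt (2 * A * B).
have qE : q ^+ 2 = 2 * A * B by rewrite sqr_sqrtr// !mulr_ge0// ltW.
have q0 : 0 < q by rewrite sqrtr_gt0 !mulr_gt0.
pose l := q * s; have l0 : 0 < l by rewrite mulr_gt0.
have bn := bmeas_norm bu.
have : E (fun x => u x ^+ 2) <=
    E (fun x => l * `|u x| + (l ^+ 2)^-1 * u x ^+ 4).
  apply: ler_Ex => [||x]; [solve_bmeas|solve_bmeas|].
  have -> : u x ^+ 4 = (`|u x| ^+ 2) ^+ 2 by rewrite real_normK ?num_real// -exprM.
  rewrite -[u x ^+ 2]real_normK ?num_real//.
  move: `|u x| (normr_ge0 (u x)) => y y0.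
  have l20 : 0 < l ^+ 2 by rewrite exprn_gt0.
  have [yl|ly] := leP y l.
    rewrite (@le_trans _ _ (l * y))//; first by rewrite expr2 ler_wpM2r.
    by rewrite lerDl mulr_ge0 ?sqr_ge0// invr_ge0 ltW.
  rewrite (@le_trans _ _ ((l ^+ 2)^-1 * (y ^+ 2) ^+ 2))//.
    rewrite mulrC ler_pdivlMr// [leRHS]expr2 ler_wpM2l ?sqr_ge0//.
    by rewrite lerXn2r ?nnegrE// ltW.
  by rewrite lerDr mulr_ge0// ltW.
rewrite ExD; [|solve_bmeas..].
rewrite !ExZ; [|solve_bmeas..].
have : (l ^+ 2)^-1 * E (fun x => u x ^+ 4) <= s ^+ 2 / (2 * A).
  rewrite mulrC ler_pdivrMr ?exprn_gt0// (le_trans h4)//.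
  rewrite /l exprMn qE le_eqVlt; apply/orP; left; apply/eqP.
  by field; rewrite gt_eqF.
move: h2; move: (E (fun x => u x ^+ 2)) (_^-1 * _) => m2 m4.
move: (E _) => m1 h2 h4' h.
have : s ^+ 2 / A <= m2 by rewrite ler_pdivrMr// mulrC.
have -> : s ^+ 2 / A = s ^+ 2 / (2 * A) * 2 by field; rewrite gt_eqF.
move=> h3; have : s ^+ 2 / (2 * A) <= l * m1 by lra.
rewrite ler_pdivrMr ?mulr_gt0// expr2 /l => h5.
by rewrite -(ler_pM2l s0); lra.
Qed.

End first_moment.

(** * Lower bound by duality for finite sums *)

Section lower_bound.
Context {d : measure_display} {T : measurableType d} {R : realType}.
Variable P : probability T R.
Local Notation E := (Ex P).
Variables (g : nat -> T -> R) (L : (T -> R) -> R) (delta : R).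
Hypothesis bg : forall k, bmeas (g k).
Hypothesis g1 : forall k x, `|g k x| <= 1.
Hypothesis linL : linear_bmeas L.
Hypothesis L1 : delta <= L (fun=> 1).
Hypothesis delta0 : 0 < delta.
Hypothesis delta1 : delta <= 1.
Hypothesis gL : small_products P g L (delta / 4).

Let eta0 : 0 <= delta / 4. Proof. by rewrite divr_ge0// ltW. Qed.
Let eta1 : delta / 4 <= 1. Proof. by move: delta1; lra. Qed.

Local Notation Nt a N t := (E (fun x => `|gsum g a N x| `^ t) `^ t^-1).

(** With eta = delta / 4 the pairing retains (delta - 2 eta) = delta / 2 of the witness value,
    against the norm bound 4 e of the Riesz product. *)
Definition low_const : R := 8 * expR 1 / delta.

(** The sum is paired by Hoelder with the Riesz product of the dual witness. Its value [W] bounds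
    every |a_j|, so it serves as [M] in [Ex_sum_riesz] and the error is absorbed. *)
Lemma gsum_lower2 (a : nat -> R) N (t : R) : 2 <= t -> exists b c : nat -> R,
  [/\ forall j, a j = b j + c j &
   \sum_(j < N) `|b j| + Num.sqrt t * Num.sqrt (\sum_(j < N) c j ^+ 2) <=
   low_const * Nt a N t].
Proof.
move=> t2; have t1 : 1 <= t by lra.
have [x [b [c [x1 xt ax abc [aM bcW]]]]] := K12_dual_witness a N _ t1.
exists b, c; split => //; apply: (le_trans bcW).
set W := \sum_(i < N) a i * x i in aM *.
have W0 : 0 <= W by apply: sumr_ge0 => i _; exact: ax.
have bS := bmeas_gsum g bg a N; have bG := bmeas_rprod g bg (fun=> 1) x N.
have := Ex_sum_riesz P g L delta _ bg linL L1 eta0 gL x x1 a W N ax aM W0.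
have ts : t^-1 + (t / (t - 1))^-1 = 1 by rewrite invf_div; field; lra.
have s0 : 0 < t / (t - 1) by rewrite divr_gt0//; lra.
have t0 : 0 < t by lra.
move=> /le_trans/(_ (Ex_hoelder P _ _ _ _ t0 s0 ts bS bG)).
have := Lnorm_riesz P g L _ bg g1 eta0 eta1 gL x N t t2 x1 xt.
move=> /(ler_wpM2l (powR_ge0 (E (fun w => `|gsum g a N w| `^ t)) t^-1)).
move=> H /le_trans/(_ H); rewrite -/W => {}H.
rewrite /low_const mulrAC ler_pdivlMr//; move: H; move: (_ `^ _) (expR 1) => z e.
by lra.
Qed.

(** The first summand serves t >= 2. The second serves 1 <= t < 2: [A] and [B] are the second and
    fourth moment constants for [Ex_norm_ge], and the outer 2 bounds sqrt t. *)
Definition lower_const : R :=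
  let A := 2 * low_const ^+ 2 in let B := (subg_const * 2) ^+ 4 in
  low_const + 2 * (2 * A * Num.sqrt (2 * A * B)).

Lemma gsum_lower (a : nat -> R) N (t : R) : 1 <= t -> exists b c : nat -> R,
  [/\ forall j, a j = b j + c j &
   \sum_(j < N) `|b j| + Num.sqrt t * Num.sqrt (\sum_(j < N) c j ^+ 2) <=
   lower_const * E (fun x => `|gsum g a N x| `^ t) `^ t^-1].
Proof.
move=> t1.
have C0 : 0 < low_const by rewrite divr_gt0// mulr_gt0// expR_gt0.
set A := 2 * low_const ^+ 2; set B := (subg_const * 2) ^+ 4 : R.
have A0 : 0 < A by rewrite mulr_gt0// exprn_gt0.
have B0 : 0 < B by rewrite exprn_gt0// !mulr_gt0// expR_gt0.
have k0 : 0 <= 2 * A * Num.sqrt (2 * A * B).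
  by apply: mulr_ge0; [rewrite mulr_ge0//; exact: ltW|exact: sqrtr_ge0].
have lcE : lower_const = low_const + 2 * (2 * A * Num.sqrt (2 * A * B)) by [].
have [t2|t2] := leP 2 t.
  have [b [c [abc H]]] := gsum_lower2 a N t t2.
  exists b, c; split => //; rewrite (le_trans H)// ler_wpM2r ?powR_ge0// lcE.
  by rewrite lerDl mulr_ge0.
have bS := bmeas_gsum g bg a N.
(* For t < 2 the splitting with zero l_1 part suffices, since sqrt t is bounded. *)
exists (fun=> 0), a; split; first by move=> j; rewrite add0r.
rewrite big1 ?add0r => [|j _]; last by rewrite normr0.
set s := Num.sqrt (\sum_(j < N) a j ^+ 2).
have a0 : 0 <= \sum_(j < N) a j ^+ 2 by apply: sumr_ge0 => j _; exact: sqr_ge0.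
have s0 : 0 <= s by exact: sqrtr_ge0.
have sE : s ^+ 2 = \sum_(j < N) a j ^+ 2 by rewrite sqr_sqrtr.
(* The case t = 2 controls |b|_1 + sqrt 2 |c|_2, which dominates the l_2 norm of a = b + c up to a
   constant because |b|_2 <= |b|_1. *)
have h2 : s ^+ 2 <= A * E (fun x => gsum g a N x ^+ 2).
  have [b [c [abc]]] := gsum_lower2 a N 2 (lexx _).
  rewrite (_ : (fun x => _ `^ 2) = (fun x => gsum g a N x ^+ 2)); last first.
    by apply/funext => x; rewrite powR_mulrn// real_normK ?num_real.
  have E0 : 0 <= E (fun x => gsum g a N x ^+ 2) by apply: Ex_ge0 => x; exact: sqr_ge0.
  rewrite powR12_sqrt//.
  have [Eb Ec] : 0 <= \sum_(j < N) `|b j| /\ 0 <= \sum_(j < N) c j ^+ 2.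
    by split; apply: sumr_ge0 => j _//; exact: sqr_ge0.
  have bb : \sum_(j < N) b j ^+ 2 <= (\sum_(j < N) `|b j|) ^+ 2.
    rewrite expr2 mulr_suml; apply: ler_sum => j _.
    rewrite -real_normK ?num_real// expr2 ler_wpM2l//.
    exact: (le_sum1 (fun j => `|b j|)).
  have : s ^+ 2 <= 2 * \sum_(j < N) b j ^+ 2 + 2 * \sum_(j < N) c j ^+ 2.
    rewrite sE !mulr_sumr -big_split/=; apply: ler_sum => j _; rewrite abc.
    by have := sqr_ge0 (b j - c j); lra.
  have cc : \sum_(j < N) c j ^+ 2 <= (Num.sqrt 2 * Num.sqrt (\sum_(j < N) c j ^+ 2)) ^+ 2.
    by rewrite exprMn !sqr_sqrtr// ler_peMl// ler1n.
  have c0 : 0 <= Num.sqrt 2 * Num.sqrt (\sum_(j < N) c j ^+ 2).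
    by rewrite mulr_ge0 ?sqrtr_ge0.
  move: Eb Ec bb cc c0; move: (Num.sqrt 2 * _) => w.
  move: (\sum_(j < N) `|b j|) => v.
  move: (\sum_(j < N) b j ^+ 2) (\sum_(j < N) c j ^+ 2) => b2 c2.
  move=> v0 c20 bv cw w0 H1 H2.
  have : (v + w) ^+ 2 <= (low_const * Num.sqrt (E (fun x => gsum g a N x ^+ 2))) ^+ 2.
    by rewrite lerXn2r ?nnegrE ?addr_ge0// mulr_ge0 ?sqrtr_ge0// ltW.
  rewrite exprMn sqr_sqrtr// /A => H3.
  have : 0 <= v * w by rewrite mulr_ge0.
  by move: H3; rewrite sqrrD => H3 vw; lra.
have h4 : E (fun x => gsum g a N x ^+ 4) <= B * s ^+ 4.
  have := Ex_powR_gsum P g L _ bg g1 eta0 eta1 gL a N 4 ltac:(by rewrite ler1n).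
  rewrite (_ : (fun x => _ `^ 4) = (fun x => gsum g a N x ^+ 4)); last first.
    apply/funext => x; rewrite powR_mulrn//.
    by rewrite (exprM _ 2 2) real_normK ?num_real// -exprM.
  rewrite powR_mulrn; last by rewrite !mulr_ge0 ?sqrtr_ge0// expR_ge0.
  rewrite -/s exprMn (_ : Num.sqrt 4 = 2)//.
  by rewrite (_ : 4 = 2 ^+ 2) ?sqrtr_sqr ?ger0_norm//; ring.
have := Ex_norm_ge P _ _ _ _ A0 B0 s0 bS h2 h4.
have := Ex_norm_le_Lnorm P _ _ t1 bS.
have := powR_ge0 (E (fun x => `|gsum g a N x| `^ t)) t^-1.
set k := 2 * A * _ in lcE k0 *; move: (_ `^ t^-1) => n.
move: (E _) => e n0 en se.
have t2' : Num.sqrt t <= 2.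
  rewrite (@le_trans _ _ (Num.sqrt (2 ^+ 2)))//; last by rewrite sqrtr_sqr ger0_norm.
  by rewrite ler_wsqrtr//; lra.
rewrite (@le_trans _ _ (2 * s))//; first by rewrite ler_wpM2r.
rewrite lcE (@le_trans _ _ (2 * (k * n)))//.
  by rewrite ler_wpM2l// (le_trans se)// ler_wpM2l.
have := mulr_ge0 (ltW C0) n0; lra.
Qed.

End lower_bound.

(** * Infinite sums *)

Section Lp_completeness.
Context {d : measure_display} {T : measurableType d} {R : realType}.
Variable mu : {measure set T -> \bar R}.

Lemma limn_einf_le (u : (\bar R)^nat) (c : \bar R) (n : nat) :
  (forall k, (n <= k)%N -> (u k <= c)%E) -> (limn_einf u <= c)%E.
Proof.
move=> uc; rewrite limn_einf_lim; apply: lime_le; first exact: is_cvg_einfs.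
apply: nearW => k; apply: (@le_trans _ _ (u (maxn k n))).
  by apply: ereal_inf_lbound; exists (maxn k n) => //=; exact: leq_maxl.
by apply: uc; exact: leq_maxr.
Qed.

Lemma limn_einf_ge0 (u : (\bar R)^nat) :
  (forall k, (0 <= u k)%E) -> (0 <= limn_einf u)%E.
Proof.
move=> u0; rewrite limn_einf_lim; apply: lime_ge; first exact: is_cvg_einfs.
by apply: nearW => k; apply: le_ereal_inf_tmp => _ [j _ <-].
Qed.

Lemma powR_le_limn_einf (z : R^nat) (l p : R) : 0 < p -> z @ \oo --> l ->
  ((`|l| `^ p)%:E <= limn_einf (fun k => (`|z k| `^ p)%:E))%E.
Proof.
move=> p0 zl; have [->|l0] := eqVneq l 0.
  rewrite normr0 powR0 ?gt_eqF//; apply: limn_einf_ge0 => k.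
  by rewrite lee_fin powR_ge0.
suff zlp : `|z k| `^ p @[k --> \oo] --> `|l| `^ p.
  have zlpE : (`|z k| `^ p)%:E @[k --> \oo] --> (`|l| `^ p)%:E.
    by apply: cvg_EFin => //; exact: nearW.
  by rewrite (cvg_limn_einf_sup zlpE).1.
have nzl : `|z k| @[k --> \oo] --> `|l| by exact: cvg_norm.
apply: (@continuous_cvg _ _ _ _ _ (fun k => `|z k|) (fun y => y `^ p) `|l|) nzl.
apply: differentiable_continuous; apply/derivable1_diffP.
by apply: derivable_powR; rewrite in_itv/= andbT normr_gt0.
Qed.

(** Fatou's lemma for the powers |Y k|^p, using pointwise convergence. *)
Lemma Lnorm_le_liminf (Y : nat -> T -> R) (S : T -> R) (p : R) (r : \bar R) (n : nat) :
  0 < p -> (0 <= r)%E -> (forall k, measurable_fun setT (Y k)) ->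
  (forall x, Y ^~ x @ \oo --> S x) ->
  (forall k, (n <= k)%N -> 'N[mu]_(p%:E)[EFin \o Y k] <= r)%E ->
  ('N[mu]_(p%:E)[EFin \o S] <= r)%E.
Proof.
move=> p0 r0 mY YS Yr.
have mS : measurable_fun setT S by apply: measurable_fun_cvg mY _ => x _; exact: YS.
have mp (f : T -> R) : measurable_fun setT f ->
    measurable_fun setT (fun x => (`|f x| `^ p)%:E).
  move=> mf; apply/measurable_EFinP; apply: (measurableT_comp (measurable_powR _)).
  exact: measurableT_comp.
have NE (f : T -> R) : (\int[mu]_x (`|f x| `^ p)%:E = 'N[mu]_(p%:E)[EFin \o f] `^ p)%E.
  by rewrite poweR_Lnorm// gt_eqF.
have H : (\int[mu]_x (`|S x| `^ p)%:E <= r `^ p)%E.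
  apply: (@le_trans _ _ (\int[mu]_x limn_einf (fun k => (`|Y k x| `^ p)%:E))%E).
    apply: ge0_le_integral => //.
    - exact: mp.
    - rewrite (_ : (fun x => _) = (fun x => - limn_esup (fun k => - (`|Y k x| `^ p)%:E))%E)//.
      apply: measurableT_comp => //; apply: measurable_fun_limn_esup => k.
      by apply: measurableT_comp => //; exact: mp.
    - by move=> x _; exact: powR_le_limn_einf.
  apply: (le_trans (fatou mu measurableT (fun k => mp _ (mY k)) _)).
    by move=> k x _; rewrite lee_fin powR_ge0.
  apply: (@limn_einf_le _ _ n) => k nk; rewrite NE.
  by apply: gt0_ler_poweR; rewrite ?in_itv/= ?leey ?andbT ?Lnorm_ge0 ?(ltW p0)//; exact: Yr.
rewrite NE in H.
have pV0 : 0 <= p^-1 by rewrite invr_ge0 ltW.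
have I0y (y : \bar R) : (0 <= y)%E -> y \in `[0%E, +oo%E] by rewrite in_itv/= leey andbT.
have := gt0_ler_poweR pV0 (I0y _ (poweR_ge0 _ _)) (I0y _ (poweR_ge0 _ _)) H.
by rewrite /= -!poweRrM mulfV ?gt_eqF// !poweRe1 ?Lnorm_ge0.
Qed.

(** Riesz-Fischer argument. The limit is built from the L_1 Cauchy condition alone; Fatou then
    transfers any L_p bound on the tails to it. *)
Lemma Lnorm_cauchy_limit (X : nat -> T -> R) :
  (forall n, measurable_fun setT (X n)) ->
  (forall e : R, 0 < e -> exists N, forall m n, (N <= n)%N -> (n <= m)%N ->
    ('N[mu]_1[EFin \o (fun x => X m x - X n x)%R] <= e%:E)%E) ->
  exists S : T -> R, measurable_fun setT S /\
    forall (p : R) (n : nat) (r : \bar R), 1 <= p -> (0 <= r)%E ->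
    (forall m, (n <= m)%N -> 'N[mu]_(p%:E)[EFin \o (fun x => X m x - X n x)%R] <= r)%E ->
    ('N[mu]_(p%:E)[EFin \o (fun x => X n x - S x)%R] <= r)%E.
Proof.
move=> mX cX.
pose e k : R := 1 / (2 ^ (k + 1))%:R.
have e0 k : 0 < e k by rewrite divr_gt0// ltr0n expn_gt0.
have /choice[N NP] k := cX (e k) (e0 k).
(* A nondecreasing choice of indices with both [N k] and [k] at most [n_ k], so consecutive
   differences have summable L_1 norms. *)
pose fix n_ k := if k is k'.+1 then (n_ k' + (N k + 1))%N else N 0%N.
have Nn k : (N k <= n_ k)%N.
  by case: k => [//|k] /=; rewrite addnA -addnA addnCA leq_addr.
have nS k : (n_ k <= n_ k.+1)%N by rewrite leq_addr.
have kn k : (k <= n_ k)%N.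
  by elim: k => // k IH /=; rewrite addnA addn1 ltnS (leq_trans IH)// leq_addr.
pose u k x := X (n_ k.+1) x - X (n_ k) x.
have mu_ k : measurable_fun setT (u k) by exact: measurable_funB.
have mnu k : measurable_fun setT (fun x => (`|u k x|)%:E).
  by apply/measurable_EFinP; exact: measurableT_comp.
pose W x := (\sum_(0 <= k <oo) (`|u k x|)%:E)%E.
have W0 x : (0 <= W x)%E by apply: nneseries_ge0 => k _ _; rewrite lee_fin.
have mW : measurable_fun setT W.
  by apply: ge0_emeasurable_sum => // k x _ _; rewrite lee_fin.
have iW : (\int[mu]_x W x < +oo)%E.
  rewrite integral_nneseries//.
  apply: (@le_lt_trans _ _ (\sum_(0 <= k <oo) (e k)%:E)%E).
    apply: lee_nneseries => [k _ _|k _]; first by apply: integral_ge0 => x _; rewrite lee_fin.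
    by have := NP k (n_ k.+1) (n_ k) (Nn k) (nS k); rewrite Lnorm1.
  by rewrite (cvg_lim _ (@cvg_geometric_eseries_half R 1 0))// ltry.
pose A := [set x | (W x < +oo)%E].
have mA : measurable A.
  have := @measurable_lte _ T R setT measurableT W (cst +oo%E) mW.
  by rewrite setTI; apply; exact: measurable_cst.
(* Setting the terms to 0 off [A], where absolute convergence may fail, yields convergence at every
   point and hence a measurable limit. *)
pose Y k x := X (n_ k) x * \1_A x.
have mY k : measurable_fun setT (Y k).
  by apply: measurable_funM => //; exact: measurable_indic.
have cY x : cvgn (Y ^~ x).
  have [xA|xA] := pselect (A x); last first.
    rewrite /Y; under eq_fun do rewrite indicE memNset// mulr0.
    exact: is_cvg_cst.
  rewrite /Y; under eq_fun do rewrite indicE mem_set// mulr1.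
  have cu : cvgn (series (u ^~ x)).
    apply: normed_cvg; apply: nondecreasing_is_cvgn.
      by apply: nondecreasing_series => k _ _; exact: normr_ge0.
    exists (fine (W x)) => _ [k _ <-].
    rewrite -lee_fin fineK ?ge0_fin_numE// /series/= -sumEFin.
    by apply: nneseries_lim_ge => j _ _; rewrite lee_fin.
  have -> : (fun k => X (n_ k) x) = (fun k => series (u ^~ x) k + X (n_ 0%N) x).
    apply/funext => k; rewrite /series/= (telescope_sumr (fun k => X (n_ k) x))//.
    by rewrite subrK.
  by apply: is_cvgD => //; exact: is_cvg_cst.
pose S x := lim (Y ^~ x @ \oo).
have YS x : Y ^~ x @ \oo --> S x by exact: cY.
exists S; split; first by apply: measurable_fun_cvg mY _ => x _; exact: YS.
move=> p n r p1 r0 Hr.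
have p0 : 0 < p by rewrite (lt_le_trans ltr01).
apply: (@Lnorm_le_liminf (fun k x => X n x - Y k x) _ p r n) => //.
- by move=> k; exact: measurable_funB.
- by move=> x; apply: cvgB; [exact: cvg_cst|exact: YS].
move=> k nk; apply: le_trans (Hr (n_ k) (leq_trans nk (kn k))).
(* Integrability of [W] makes the complement of [A] negligible, so [Y k] and [X (n_ k)] give the
   same norm. *)
rewrite unlock; rewrite le_eqVlt; apply/orP; left; apply/eqP; congr (_ `^ _)%E.
apply: ge0_ae_eq_integral => //.
- apply: (measurableT_comp (measurable_poweR _)).
  apply: measurableT_comp => //; apply/measurable_EFinP; exact: measurable_funB.
- apply: (measurableT_comp (measurable_poweR _)).
  apply: measurableT_comp => //; apply/measurable_EFinP; exact: measurable_funB.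
- by move=> x _; exact: poweR_ge0.
- by move=> x _; exact: poweR_ge0.
have : mu.-integrable setT W.
  by apply/integrableP; split => //; under eq_integral do rewrite gee0_abs//.
move=> /(integrable_ae measurableT); apply: filterS => x /(_ I) Wx _ /=.
have xA : A x by rewrite /A/= -ge0_fin_numE.
by rewrite /Y indicE (mem_set xA) mulr1 distrC.
Qed.

End Lp_completeness.

(** * Square-summable sequences, their tails and the K-functional *)

Section little_lp.
Context {R : realType}.
Implicit Types (a b c : nat -> R).

Definition sqtail a N : \bar R := (\sum_(N <= k <oo) (a k ^+ 2)%:E)%E.

Lemma sqtail_ge0 a N : (0 <= sqtail a N)%E.
Proof. by apply: nneseries_ge0 => k _ _; rewrite lee_fin sqr_ge0. Qed.

Lemma Lnorm2_counting a :
  'N[@counting _ R]_(2%:E)[EFin \o a]%E = (sqtail a 0 `^ 2^-1)%E.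
Proof.
rewrite Lnorm_counting//; congr (_ `^ _)%E; apply: eq_eseriesr => k _.
by rewrite /= ?poweR_EFin powR_mulrn// real_normK ?num_real.
Qed.

Lemma Lnorm1_counting b :
  'N[@counting _ R]_(1%:E)[EFin \o b]%E = (\sum_(0 <= k <oo) (`|b k|)%:E)%E.
Proof.
rewrite Lnorm_counting// invr1 poweRe1; last first.
  by apply: nneseries_ge0 => k _ _; exact: poweR_ge0.
by apply: eq_eseriesr => k _; rewrite /= ?poweR_EFin powRr1.
Qed.

Lemma sqtail0_lty a : in_l2 a -> (sqtail a 0 < +oo)%E.
Proof.
rewrite /in_l2 Lnorm2_counting => /(lty_poweRy); apply.
  by rewrite invr_eq0 pnatr_eq0.
Qed.

Lemma sqtail_split a N M : (N <= M)%N ->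
  sqtail a N = ((\sum_(N <= k < M) a k ^+ 2)%:E + sqtail a M)%E.
Proof.
move=> NM; rewrite /sqtail (nneseries_split N (M - N)) => [|k _]; last first.
  by rewrite lee_fin sqr_ge0.
by rewrite subnKC// sumEFin.
Qed.

Lemma le_partial_Lnorm2 c N :
  ((Num.sqrt (\sum_(k < N) c k ^+ 2))%:E <= 'N[@counting _ R]_(2%:E)[EFin \o c])%E.
Proof.
have s0 : 0 <= \sum_(k < N) c k ^+ 2 by apply: sumr_ge0 => k _; exact: sqr_ge0.
rewrite Lnorm2_counting -powR12_sqrt// -poweR_EFin.
apply: gt0_ler_poweR; rewrite ?in_itv/= ?leey ?andbT ?lee_fin ?sqtail_ge0//.
by rewrite (sqtail_split _ 0 N)// big_mkord leeDl// sqtail_ge0.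
Qed.

Lemma le_partial_Lnorm1 b N :
  ((\sum_(k < N) `|b k|)%:E <= 'N[@counting _ R]_(1%:E)[EFin \o b])%E.
Proof.
rewrite Lnorm1_counting -(big_mkord xpredT (fun k => `|b k|)) -sumEFin.
by apply: nneseries_lim_ge => k _ _; rewrite lee_fin.
Qed.

Lemma sqrtr_subadd (x y : R) : 0 <= x -> 0 <= y ->
  Num.sqrt (x + y) <= Num.sqrt x + Num.sqrt y.
Proof.
move=> x0 y0; have sx := sqrtr_ge0 x; have sy := sqrtr_ge0 y.
rewrite -(ler_pXn2r (n := 2))// ?nnegrE ?sqrtr_ge0 ?addr_ge0//.
rewrite sqrrD !sqr_sqrtr ?addr_ge0// addrAC lerDl.
by rewrite mulrn_wge0// mulr_ge0.
Qed.

Variable a : nat -> R.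
Hypothesis la : in_l2 a.

Let r N : R := fine (sqtail a N).

Lemma sqtailE N : sqtail a N = (r N)%:E.
Proof.
rewrite fineK// ge0_fin_numE ?sqtail_ge0//.
rewrite (le_lt_trans _ (sqtail0_lty _ la))// (sqtail_split _ 0 N)// leeDr//.
by rewrite lee_fin; apply: sumr_ge0 => k _; exact: sqr_ge0.
Qed.

Lemma tail_ge0 N : 0 <= r N.
Proof. by rewrite -lee_fin -sqtailE sqtail_ge0. Qed.

Lemma tail_cvg0 : r @ \oo --> 0.
Proof.
apply: fine_cvg; apply: nneseries_tail_cvg; first exact: sqtail0_lty.
by move=> k _; rewrite lee_fin sqr_ge0.
Qed.

Lemma le_partial_tail N M : \sum_(N <= k < M) a k ^+ 2 <= r N.
Proof.
have [NM|/ltnW MN] := leqP N M; last by rewrite big_geq ?tail_ge0.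
by rewrite -lee_fin -sqtailE (sqtail_split _ _ _ NM) leeDl// sqtail_ge0.
Qed.

(** A splitting of the first [N] terms extends to all of [a] by placing the tail entirely in the l_2
    part. *)
Lemma K12_le_partial (t : R) (b c : nat -> R) N : 0 <= t ->
  (forall j, a j = b j + c j) ->
  (K12 t a <= (\sum_(j < N) `|b j| +
     t * (Num.sqrt (\sum_(j < N) c j ^+ 2) + Num.sqrt (r N)))%:E)%E.
Proof.
move=> t0 abc.
pose b' j := if (j < N)%N then b j else 0.
pose c' j := if (j < N)%N then c j else a j.
have Nb : ('N[@counting _ R]_(1%:E)[EFin \o b'] = (\sum_(j < N) `|b j|)%:E)%E.
  rewrite Lnorm1_counting (nneseries_split 0 N) => [|k _]; last by rewrite lee_fin.
  rewrite add0n [X in (_ + X)%E]eseries0 ?adde0 => [|k Nk _]; last first.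
    by rewrite /b' ltnNge Nk normr0.
  rewrite sumEFin big_mkord; congr EFin; apply: eq_bigr => j _.
  by rewrite /b' ltn_ord.
have c0 : 0 <= \sum_(j < N) c j ^+ 2 by apply: sumr_ge0 => k _; exact: sqr_ge0.
have Nc : ('N[@counting _ R]_(2%:E)[EFin \o c'] = (Num.sqrt (\sum_(j < N) c j ^+ 2 + r N))%:E)%E.
  rewrite Lnorm2_counting (sqtail_split _ 0 N)//.
  have -> : sqtail c' N = sqtail a N.
    apply/congr_lim/funext => n; apply: eq_big_nat => k /andP[Nk _].
    by rewrite /c' ltnNge Nk.
  rewrite sqtailE big_mkord -EFinD poweR_EFin powR12_sqrt.
    congr (Num.sqrt (_ + _))%:E; apply: eq_bigr => j _.
    by rewrite /c' ltn_ord.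
  by rewrite addr_ge0 ?tail_ge0//; apply: sumr_ge0 => k _; exact: sqr_ge0.
apply: (@le_trans _ _ ('N[@counting _ R]_(1%:E)[EFin \o b']
            + t%:E * 'N[@counting _ R]_(2%:E)[EFin \o c'])%E).
  apply: ereal_inf_lbound; exists b', c'; split => //.
  - move=> j; rewrite /b' /c'; case: ifP => _; first exact: abc.
    by rewrite add0r.
  - by rewrite Nb ltry.
  - by rewrite Nc ltry.
rewrite Nb Nc -EFinM -EFinD lee_fin lerD2l ler_wpM2l//.
by rewrite sqrtr_subadd ?tail_ge0.
Qed.

End little_lp.

(** * Passage from partial sums to series *)

Section infinite_sums.
Context {d : measure_display} {T : measurableType d} {R : realType}.
Variable P : probability T R.
Variables (phi : nat -> T -> R) (D B C : R).
Hypothesis bphi : forall k, bmeas (phi k).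
Hypothesis D0 : 0 <= D.
Hypothesis phiD : forall k x, `|phi k x| <= D.
Hypothesis B0 : 0 <= B.
Hypothesis upper : forall (a : nat -> R) N (t : R), 1 <= t ->
  ('N[P]_(t%:E)[EFin \o gsum phi a N] <=
   (B * Num.sqrt t * Num.sqrt (\sum_(i < N) a i ^+ 2))%:E)%E.
Hypothesis C1 : 1 <= C.
Hypothesis BC : B <= C.
Hypothesis DC : D <= C.
Hypothesis lower : forall (a : nat -> R) N (t : R), 1 <= t -> exists b c : nat -> R,
  (forall j, a j = b j + c j) /\
  ((\sum_(j < N) `|b j| + Num.sqrt t * Num.sqrt (\sum_(j < N) c j ^+ 2))%:E <=
    C%:E * 'N[P]_(t%:E)[EFin \o gsum phi a N])%E.

Lemma gsumB (a : nat -> R) N M x : (N <= M)%N ->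
  gsum phi a M x - gsum phi a N x = gsum phi (fun i => if (N <= i)%N then a i else 0) M x.
Proof.
move=> NM; rewrite /gsum -!(big_mkord xpredT (fun i => a i * phi i x)).
rewrite -(big_mkord xpredT (fun i => (if (N <= i)%N then a i else 0) * phi i x)).
rewrite (@big_cat_nat _ _ _ N 0%N M)//= addrAC subrr add0r.
rewrite [RHS](@big_cat_nat _ _ _ N 0%N M)//=.
rewrite [X in _ = X + _]big_nat_cond [X in _ = X + _]big1 ?add0r.
  by rewrite big_nat_cond [RHS]big_nat_cond; apply: eq_bigr => i /andP[/andP[-> _] _].
by move=> i /andP[/andP[_ iN] _]; rewrite leqNgt iN mul0r.
Qed.

(** A block of the series is a partial sum for the coefficients set to 0 below [N], so the finite
    upper bound applies to it. *)
Lemma Lnorm_gsumB (a : nat -> R) N M (t : R) : in_l2 a -> 1 <= t -> (N <= M)%N ->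
  ('N[P]_(t%:E)[EFin \o (fun x => gsum phi a M x - gsum phi a N x)%R] <=
   (B * Num.sqrt t * Num.sqrt (fine (sqtail a N)))%:E)%E.
Proof.
move=> la t1 NM; under eq_fun do rewrite gsumB//.
apply: (le_trans (upper _ _ _ t1)); rewrite lee_fin.
rewrite ler_wpM2l ?mulr_ge0 ?sqrtr_ge0// ler_wsqrtr//.
rewrite -(big_mkord xpredT (fun i => (if (N <= i)%N then a i else 0) ^+ 2)).
rewrite (@big_cat_nat _ _ _ N 0%N M)//= big_nat_cond big1 ?add0r.
  apply: le_trans (le_partial_tail _ la N M).
  rewrite big_nat_cond [leRHS]big_nat_cond le_eqVlt; apply/orP; left; apply/eqP.
  by apply: eq_bigr => i /andP[/andP[-> _] _].
by move=> i /andP[/andP[_ iN] _]; rewrite leqNgt iN expr0n.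
Qed.

Lemma cvg_sqrt_tail (a : nat -> R) (k : R) : in_l2 a ->
  k * Num.sqrt (fine (sqtail a N)) @[N --> \oo] --> (0 : R).
Proof.
move=> la; rewrite -(mulr0 k); apply: cvgMr; rewrite -(@sqrtr0 R).
exact: (continuous_cvg _ (@sqrt_continuous R 0) (tail_cvg0 _ la)).
Qed.

Lemma near_sqrt_tail (a : nat -> R) (k e : R) : in_l2 a -> 0 < e ->
  exists N0, forall N, (N0 <= N)%N -> k * Num.sqrt (fine (sqtail a N)) <= e.
Proof.
move=> la e0; have /cvgrPdist_le/(_ _ e0)[N0 _ H] := cvg_sqrt_tail _ k la.
exists N0 => N /H /=; rewrite sub0r normrN; exact: le_trans (ler_norm _).
Qed.

Theorem K12_equivalence (t : R) (a : nat -> R) : 1 <= t -> in_l2 a ->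
  exists S : T -> R,
    [/\ measurable_fun setT S,
        ('N[P]_(t%:E)[EFin \o S] < +oo)%E,
        (fun N => ('N[P]_(t%:E)[EFin \o
             (fun x : T => (gsum phi a N x - S x)%R)])%E) @ \oo --> 0%E,
        ((C^-1)%:E * K12 (Num.sqrt t) a <= 'N[P]_(t%:E)[EFin \o S])%E &
        ('N[P]_(t%:E)[EFin \o S] <= C%:E * K12 (Num.sqrt t) a)%E].
Proof.
move=> t1 la.
have t0 : 0 < t by rewrite (lt_le_trans ltr01).
have st0 := sqrtr_ge0 t.
have C0 : 0 < C by rewrite (lt_le_trans ltr01).
have mS N (b : nat -> R) : measurable_fun setT (gsum phi b N).
  by have [] := bmeas_gsum phi bphi b N.
have [|S [mS' HS]] := Lnorm_cauchy_limit P (gsum phi a) (fun N => mS N a).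
  move=> e e0; have [N0 H] := near_sqrt_tail a (B * Num.sqrt 1) e la e0.
  exists N0 => m n N0n nm.
  by apply: (le_trans (Lnorm_gsumB _ _ _ _ la (lexx _) nm)); rewrite lee_fin H.
pose q N := B * Num.sqrt t * Num.sqrt (fine (sqtail a N)).
have q0 N : 0 <= q N by rewrite !mulr_ge0 ?sqrtr_ge0.
have {}HS N : ('N[P]_(t%:E)[EFin \o (fun x => gsum phi a N x - S x)%R] <= (q N)%:E)%E.
  by apply: HS => [//||m Nm]; [rewrite lee_fin|exact: Lnorm_gsumB].
have NS N : ('N[P]_(t%:E)[EFin \o S] <= 'N[P]_(t%:E)[EFin \o gsum phi a N] + (q N)%:E)%E.
  have m1 : measurable_fun setT (fun x => S x - gsum phi a N x) by exact: measurable_funB.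
  rewrite {1}(_ : S = (gsum phi a N \+ (fun x => S x - gsum phi a N x))%R); last first.
    by apply/funext => x /=; rewrite subrKC.
  apply: (le_trans (minkowski_EFin _ (mS N a) m1 t1)); rewrite leeD2l//.
  rewrite -oppe_Lnorm; apply: le_trans (HS N).
  rewrite le_eqVlt; apply/orP; left; apply/eqP; apply: eq_Lnorm => x /=.
  by rewrite opprB.
have SN N : ('N[P]_(t%:E)[EFin \o gsum phi a N] <= 'N[P]_(t%:E)[EFin \o S] + (q N)%:E)%E.
  have m1 : measurable_fun setT (fun x => gsum phi a N x - S x) by exact: measurable_funB.
  rewrite {1}(_ : gsum phi a N = (S \+ (fun x => gsum phi a N x - S x))%R); last first.
    by apply/funext => x /=; rewrite subrKC.
  by apply: (le_trans (minkowski_EFin _ mS' m1 t1)); rewrite leeD2l.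
exists S; split => //.
- apply: (le_lt_trans (NS 0%N)); rewrite lte_add_pinfty ?ltry//.
  by apply: (le_lt_trans (upper _ _ _ t1)); rewrite ltry.
- apply: (@squeeze_cvge _ _ _ _ (fun=> 0%E) _ (fun N => (q N)%:E)).
  + by apply: nearW => N; rewrite HS Lnorm_ge0.
  + exact: cvg_cst.
  + by apply: cvg_EFin; [exact: nearW|exact: cvg_sqrt_tail].
- rewrite lee_pdivrMl//; apply/lee_addgt0Pr => e e0.
  (* The tail is paid twice: C * q N for replacing the partial sum by [S], and sqrt t times the l_2
     tail for extending the splitting of the partial sum. *)
  have [N H] := near_sqrt_tail a (C * (B * Num.sqrt t) + Num.sqrt t) e la e0.
  have {}H := H N (leqnn N).
  have [b [c [abc low]]] := lower a N t t1.
  apply: (le_trans (K12_le_partial _ la _ _ _ N st0 abc)).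
  rewrite mulrDr addrA EFinD; apply: (le_trans (leeD2r _ low)).
  apply: (le_trans (leeD2r _ (lee_wpmul2l _ (SN N)))); first by rewrite lee_fin ltW.
  rewrite muleDr ?ge0_adde_def ?inE ?Lnorm_ge0 ?lee_fin//.
  rewrite -addeA leeD2l// -EFinM -EFinD lee_fin (le_trans _ H)//.
  by rewrite mulrDl /q !mulrA.
rewrite -lee_pdivrMl//; apply: le_ereal_inf_tmp => _ [b [c [abc b1 c2 ->]]].
rewrite lee_pdivrMl//; apply/lee_addgt0Pr => e e0.
have [N H] := near_sqrt_tail a (B * Num.sqrt t) e la e0.
apply: (le_trans (NS N)); apply: leeD; last by rewrite lee_fin H.
(* For a fixed splitting, the [b] part is bounded pointwise by D |b|_1 and the [c] part by the
   subgaussian estimate. *)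
rewrite (_ : gsum phi a N = (gsum phi b N \+ gsum phi c N)%R); last first.
  apply/funext => x; rewrite /gsum /= -big_split/=; apply: eq_bigr => i _.
  by rewrite abc mulrDl.
apply: (le_trans (minkowski_EFin _ (mS N b) (mS N c) t1)).
rewrite muleDr ?ge0_adde_def ?inE ?mule_ge0 ?Lnorm_ge0 ?lee_fin//.
apply: leeD.
  apply: (@le_trans _ _ (C%:E * (\sum_(i < N) `|b i|)%:E)%E); last first.
    by rewrite lee_wpmul2l ?lee_fin ?(ltW C0)// le_partial_Lnorm1.
  have b0 : 0 <= \sum_(i < N) `|b i| by apply: sumr_ge0.
  rewrite -EFinM; apply: Lnorm_le_bound => //.
  - by rewrite mulr_ge0// ltW.
  - exact: bmeas_gsum.
  move=> x; rewrite mulr_sumr (le_trans (ler_norm_sum _ _ _))//.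
  apply: ler_sum => i _; rewrite normrM mulrC ler_wpM2r//.
  by rewrite (le_trans (phiD i x)).
apply: (le_trans (upper _ _ _ t1)).
rewrite -mulrA EFinM.
apply: (@le_trans _ _ (C%:E * (Num.sqrt t * Num.sqrt (\sum_(i < N) c i ^+ 2))%:E)%E).
  by rewrite lee_wpmul2r// lee_fin mulr_ge0// sqrtr_ge0.
rewrite lee_wpmul2l ?lee_fin ?(ltW C0)// EFinM lee_wpmul2l ?lee_fin//.
exact: le_partial_Lnorm2.
Qed.

End infinite_sums.

(** * Rescaling to functions bounded by 1 and choice of the constant *)

Section normalization.
Context {d : measure_display} {T : measurableType d} {R : realType}.
Variable P : probability T R.

Lemma bmeas_Lnorm_lty (h : T -> R) : bmeas h -> ('N[P]_(2%:E)[EFin \o h] < +oo)%E.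
Proof. by move=> bh; rewrite Lnorm_Ex// ltry. Qed.

Lemma weak_Ex_cvg (f : nat -> T -> R) (h : T -> R) : (forall k, bmeas (f k)) ->
  weak_L2_to0 P f -> bmeas h ->
  Ex P (fun x => f k x * h x) @[k --> \oo] --> (0 : R).
Proof.
by move=> bf wf bh; exact: fine_cvg (wf h bh.1 (bmeas_Lnorm_lty _ bh)).
Qed.

Lemma gsum_scale (g : nat -> T -> R) (c : R) (a : nat -> R) N :
  gsum (fun k x => c * g k x) a N = gsum g (fun i => c * a i) N.
Proof. by apply/funext => x; apply: eq_bigr => i _; rewrite mulrCA mulrA. Qed.

Lemma sqrt_sum_scale (c : R) (a : nat -> R) N : 0 <= c ->
  Num.sqrt (\sum_(i < N) (c * a i) ^+ 2) = c * Num.sqrt (\sum_(i < N) a i ^+ 2).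
Proof.
move=> c0; under eq_bigr do rewrite exprMn.
by rewrite -mulr_sumr sqrtrM ?sqr_ge0// sqrtr_sqr ger0_norm.
Qed.

End normalization.

Theorem theorem3p2 (R : realType) (D dd : R) :
  exists C : R, 1 <= C /\
  forall (disp : measure_display) (T : measurableType disp)
         (P : probability T R) (f : nat -> T -> R) (nk : nat -> nat),
    (forall n, measurable_fun setT (f n)) ->
    {homo nk : m n / (m < n)%N} ->
    (forall k x, `|f (nk k) x| <= D) ->
    weak_L2_to0 P (fun k => f (nk k)) ->
    (dd%:E = ereal_inf [set 'N[P]_(2%:E)[EFin \o f (nk k)] | k in setT])%E ->
    0 < dd ->
    exists m : nat -> nat, injective m /\
    forall (t : R), 1 <= t -> forall a : nat -> R, in_l2 a ->
      exists S : T -> R,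
        [/\ measurable_fun setT S,
            ('N[P]_(t%:E)[EFin \o S] < +oo)%E,
            (fun N => ('N[P]_(t%:E)[EFin \o
                 (fun x : T => (\sum_(i < N) a i * f (m i) x - S x)%R)])%E) @ \oo --> 0%E,
            ((C^-1)%:E * K12 (Num.sqrt t) a <= 'N[P]_(t%:E)[EFin \o S])%E &
            ('N[P]_(t%:E)[EFin \o S] <= C%:E * K12 (Num.sqrt t) a)%E].
Proof.
(* [M] is the normalizing factor and [delta] bounds the second moments after normalization from
   below. No sign of [D] or [dd] is known yet, so [M] may be 0, with division by it returning 0; 0 <
   M follows later from dd <= M. *)
pose M := `|D|; pose delta := (dd / M) ^+ 2.
pose B : R := M * subg_const; pose K : R := lower_const delta / M.
have M0 : 0 <= M by exact: normr_ge0.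
have B0 : 0 <= B by rewrite !mulr_ge0// expR_ge0.
(* The sum dominates each constant needed: 1, the upper constant [B], the pointwise bound [M] and
   the lower constant [K], in absolute value since its sign is not yet available. *)
exists (1 + B + M + `|K|); split.
  by rewrite -addrA -addrA lerDl !addr_ge0.
move=> disp T P f nk mf nkS fD wf ddE dd0.
have fM k x : `|f (nk k) x| <= M by rewrite (le_trans (fD k x))// ler_norm.
have bf k : bmeas (f (nk k)) by split; [exact: mf|exists M => x; exact: fM].
have ddf k : (dd%:E <= 'N[P]_(2%:E)[EFin \o f (nk k)])%E.
  by rewrite ddE; apply: ereal_inf_lbound; exists k.
have ddM : dd <= M.
  rewrite -lee_fin (le_trans (ddf 0%N))//; exact: Lnorm_le_bound.
have {}M0 : 0 < M by rewrite (lt_le_trans dd0).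
have delta0 : 0 < delta by rewrite exprn_gt0// divr_gt0.
have delta1 : delta <= 1.
  by rewrite expr_le1// ?divr_ge0 ?(ltW dd0)// ?(ltW M0)// ler_pdivrMr// mul1r.
pose g0 k x := M^-1 * f (nk k) x.
have bg0 k : bmeas (g0 k) by exact: bmeasZ.
have g01 k x : `|g0 k x| <= 1.
  by rewrite normrM normfV (gtr0_norm M0) mulrC ler_pdivrMr// mul1r.
have wg0 h : bmeas h -> Ex P (fun x => g0 k x * h x) @[k --> \oo] --> (0 : R).
  move=> bh; rewrite (_ : (fun k => _) = (fun k => M^-1 * Ex P (fun x => f (nk k) x * h x))).
    by rewrite -(mulr0 M^-1); apply: cvgMr; exact: weak_Ex_cvg.
  apply/funext => k; rewrite -ExZ; last exact: bmeasM.
  by congr Ex; apply/funext => x; rewrite mulrA.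
have dg0 k : delta <= Ex P (fun x => g0 k x ^+ 2).
  have := ddf k; rewrite Lnorm_Ex// lee_fin powR12_sqrt; last first.
    by apply: Ex_ge0 => x; exact: powR_ge0.
  rewrite (_ : (fun x => `|_| `^ 2) = (fun x => f (nk k) x ^+ 2)); last first.
    by apply/funext => x; rewrite powR_mulrn// real_normK ?num_real.
  have E0 : 0 <= Ex P (fun x => f (nk k) x ^+ 2) by apply: Ex_ge0 => x; exact: sqr_ge0.
  move=> H; have : dd ^+ 2 <= Ex P (fun x => f (nk k) x ^+ 2).
    by rewrite -[leRHS]sqr_sqrtr// lerXn2r ?nnegrE ?sqrtr_ge0// ltW.
  move=> {}H; rewrite (_ : (fun x => _) = (fun x => (M^-1) ^+ 2 * f (nk k) x ^+ 2)); last first.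
    by apply/funext => x; rewrite exprMn.
  rewrite ExZ; last exact: bmeasX.
  by rewrite /delta exprMn mulrC ler_wpM2l ?sqr_ge0.
have eta0 : 0 < delta / 4 by rewrite divr_gt0.
have [s [sS [L [linL L1 gL]]]] := lacunary_subsequence P _ _ _ bg0 g01 wg0 dg0 eta0.
pose g i := g0 (s i).
have bg i : bmeas (g i) by exact: bg0.
have g1 i x : `|g i x| <= 1 by exact: g01.
exists (fun i => nk (s i)); split.
  have inj (h : nat -> nat) : (forall i j, (i < j)%N -> (h i < h j)%N) -> injective h.
    move=> hS i j hij; have [ij|ij|//] := ltngtP i j.
      by have := hS _ _ ij; rewrite hij ltnn.
    by have := hS _ _ ij; rewrite hij ltnn.
  by apply: inj => i j ij; apply: nkS; exact: sS.
have fg : (fun i => f (nk (s i))) = (fun i x => M * g i x).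
  by apply/funext => i; apply/funext => x; rewrite /g /g0 mulVKf// gt_eqF.
have K0 := ler_norm K.
move=> t t1 a la; apply: (K12_equivalence P (fun i => f (nk (s i))) M B) => //.
- move=> b N {t1} {}t t1; rewrite fg gsum_scale.
  have eta1 : delta / 4 <= 1 by rewrite ler_pdivrMr// mul1r (le_trans delta1)// ler1n.
  apply: (le_trans (Lnorm_gsum P g L (delta / 4) bg g1 (ltW eta0) eta1 gL _ _ _ t1)).
  by rewrite lee_fin sqrt_sum_scale ?(ltW M0)// mulrCA /B !mulrA lexx.
- by rewrite -!addrA lerDl !addr_ge0// ltW.
- by rewrite -!addrA addrCA lerDl !addr_ge0// ltW.
- by rewrite addrAC lerDr !addr_ge0.
move=> b N {t1} {}t t1.
(* The subsystem is [M] times [g], so the finite bound is used for the coefficients M b_i and the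
   resulting splitting is divided by [M]. *)
have [u [v [uv H]]] := gsum_lower P g L delta bg g1 linL L1 delta0 delta1 gL
  (fun i => M * b i) N t t1.
exists (fun i => M^-1 * u i), (fun i => M^-1 * v i); split.
  by move=> j; rewrite -mulrDr -uv mulKf// gt_eqF.
rewrite fg gsum_scale Lnorm_Ex ?(lt_le_trans ltr01)//; last exact: bmeas_gsum.
have MV0 : 0 <= M^-1 by rewrite invr_ge0 ltW.
rewrite sqrt_sum_scale// -EFinM lee_fin.
have -> : \sum_(j < N) `|M^-1 * u j| = M^-1 * \sum_(j < N) `|u j|.
  by rewrite mulr_sumr; apply: eq_bigr => j _; rewrite normrM (ger0_norm MV0).
rewrite mulrCA -mulrDr (le_trans (ler_wpM2l MV0 H))// mulrA ler_wpM2r ?powR_ge0//.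
by rewrite [M^-1 * _]mulrC (le_trans K0)// lerDr !addr_ge0// ltW.
Qed.
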